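(* Let $\nu>0$, $b\ge0$, $a,c\in\mathbb{R}$, $x_0^2:=a^2+4\nu b$, and $k_m\ge0$, $\omega_m>0$ fixed. Let $D^\infty=\{(\omega,k):\omega_m\le|\omega|<+\infty,\ k_m\le|k|<+\infty\}$. For small overlap $L>0$, the Robin best approximation problem $$\inf_{p\in\mathbb{C}}\sup_{(\omega,k)\in D^\infty}|\rho(\omega,k,p,0,L)|$$ has a unique solution $(p_{0,\infty}^*(L),\delta_{0,\infty}^*(L))$ (minimizer and minimal value), and as $L\to0$ $$p_{0,\infty}^*(L)\sim\frac12\sqrt[3]{\frac{\nu A^2}{L}},\qquad \delta_{0,\infty}^*(L)\sim 1-\frac{A}{2p_{0,\infty}^*(L)},$$ with $A$ the constant defined in the context.
   Context: This concerns the optimized Schwarz waveform relaxation algorithm for $\partial_t u+(a,c)\cdot\nabla u-\nu\Delta u+bu=f$ on $\mathbb{R}^2$, decomposed into $\Omega_1=(-\infty,L)\times\mathbb{R}$ and $\Omega_2=(0,\infty)\times\mathbb{R}$ ($L\ge0$ the overlap), with transmission operators $(\nu\nabla-\tfrac{(a,c)^T}{2})\cdot n_i+\tfrac{s}{2}$, $s=p+q(\partial_t+c\partial_y-\nu\Delta_y)$; its convergence factor in Fourier variables $(\omega,k)$ is $$\rho(\omega,k,p,q,L)=\frac{p+q(\nu k^2+i(\omega+ck))-\sqrt{x_0^2+4\nu(\nu k^2+i(\omega+ck))}}{p+q(\nu k^2+i(\omega+ck))+\sqrt{x_0^2+4\nu(\nu k^2+i(\omega+ck))}}\,e^{-\frac{L}{2\nu}\sqrt{x_0^2+4\nu(\nu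 k^2+i(\omega+ck))}},$$ with $\sqrt{\cdot}$ the branch with positive real part; Robin conditions correspond to $q=0$. Define $$\bar k=|c|\frac{\sqrt{(c^2+x_0^2)^2+16\nu^2\omega_m^2}-(c^2+x_0^2)}{8\nu^2\omega_m},\qquad \varphi(k,\xi)=2\sqrt2\sqrt{\sqrt{(x_0^2+4\nu^2k^2)^2+16\nu^2\xi^2}+x_0^2+4\nu^2k^2},$$ and $A=\varphi(\bar k,-\omega_m+|c|\bar k)$ if $k_m\le\bar k$; $A=\varphi(k_m,-\omega_m+|c|k_m)$ if $\bar k\le k_m\le\omega_m/|c|$; $A=\varphi(k_m,0)$ if $k_m\ge\omega_m/|c|$. Standing assumption: either $x_0^2+4\nu^2k_m^2\ne0$ or $\omega_m\ne0$. $\sim$ denotes asymptotic equivalence as $L\to0$. *)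

(* Defs.v *)
From Stdlib Require Import Reals Lra.
From Coquelicot Require Import Coquelicot.
Open Scope R_scope.

Definition cexp (z : C) : C := (exp (Re z) * cos (Im z), exp (Re z) * sin (Im z)).

(* Square root branch with nonnegative real part (principal branch):
   Re = sqrt((|w|+Re w)/2), Im = sign(Im w) sqrt((|w|-Re w)/2). *)
Definition csqrt (w : C) : C :=
  (sqrt ((Cmod w + Re w) / 2),
   (if Rlt_dec (Im w) 0 then -1 else 1) * sqrt ((Cmod w - Re w) / 2)).

Definition x0sq (nu a b : R) : R := a ^ 2 + 4 * nu * b.

Definition rho (nu a b c : R) (w k : R) (p : C) (q : R) (L : R) : C :=
  let z : C := (nu * k ^ 2, w + c * k) in
  let s : C := csqrt (RtoC (x0sq nu a b) + RtoC (4 * nu) * z) in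
  ((p + RtoC q * z - s) / (p + RtoC q * z + s)) * cexp (RtoC (- L / (2 * nu)) * s).

Definition Dinf (km wm : R) (w k : R) : Prop := wm <= Rabs w /\ km <= Rabs k.

Definition robin_sup (nu a b c km wm L : R) (p : C) : Rbar :=
  Lub_Rbar (fun y => exists w k, Dinf km wm w k /\ y = Cmod (rho nu a b c w k p 0 L)).

Definition robin_solution (nu a b c km wm L : R) (p : C) (delta : R) : Prop :=
  robin_sup nu a b c km wm L p = Finite delta /\
  forall p' : C, Rbar_le (Finite delta) (robin_sup nu a b c km wm L p').

Definition kbar (nu a b c wm : R) : R :=
  let X := c ^ 2 + x0sq nu a b in
  Rabs c * (sqrt (X ^ 2 + 16 * nu ^ 2 * wm ^ 2) - X) / (8 * nu ^ 2 * wm).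

Definition phi (nu a b : R) (k xi : R) : R :=
  let X := x0sq nu a b + 4 * nu ^ 2 * k ^ 2 in
  2 * sqrt 2 * sqrt (sqrt (X ^ 2 + 16 * nu ^ 2 * xi ^ 2) + X).

(* When c = 0, omega_m/|c| = +infinity, so the third case never applies. *)
Definition Aconst (nu a b c km wm : R) : R :=
  let kb := kbar nu a b c wm in
  if Rle_dec km kb then phi nu a b kb (- wm + Rabs c * kb)
  else if Rle_dec km (wm / Rabs c) then phi nu a b km (- wm + Rabs c * km)
  else if Req_EM_T c 0 then phi nu a b km (- wm + Rabs c * km)
  else phi nu a b km 0.

(* Main.v *)
Require Import Defs.
From Stdlib Require Import Reals Lra Psatz.
From Coquelicot Require Import Coquelicot.
Open Scope R_scope.

(** Let [K] be the set of values [s = x + i y] of the square root. Since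
    [x ^ 2 - y ^ 2 = x0 ^ 2 + 4 nu ^ 2 k ^ 2 >= 0], [K] lies in the sector [|y| <= x]; it is
    symmetric under conjugation, [A / 4] is the minimum of [x] on [K], and [K] contains points
    with [y] close to [x] for every large [x]. Put [lam = L / nu] and
    [P = (nu A ^ 2 / L) ^ (1/3) / 2], so that [lam P ^ 3 = A ^ 2 / 8].

    Asymptotically [1 - delta ^ 2] is bounded by [A / p] (point of minimal [x]) and by
    [lam x + 2 p / x] (points with [y] close to [x]); both bounds balance at [p = P],
    [x = 4 P ^ 2 / A], and [P] itself nearly attains them.

    The condition [|p - s| <= delta exp (lam x / 2) |p + s|] says that [p] lies in a disc
    (Apollonius) when [delta exp (lam x / 2) < 1], and it holds on the whole sector
    [|Im p| <= Re p] otherwise. For small [L] every good [p] lies strictly inside that sector,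
    so that the midpoint of two distinct good parameters is strictly better: the optimum is
    unique, hence real by symmetry, and it exists because the supremum is locally Lipschitz
    in [p > 0]. *)

(** * The reduced problem: bounds over a set of square roots *)

(** This is the modulus of [rho] for [q = 0] and [lam = L / nu], with the square root [s] itself as
    the variable; the frequencies then matter only through the set of values of [s]. *)
Definition robin_val (lam : R) (p s : C) : R :=
  Cmod ((p - s) / (p + s)) * exp (- lam / 2 * Re s).

(* [x0], [c0] and [b0] correspond to the paper's [A / 4], to [x_0 ^ 2 + 4 nu ^ 2 k_m ^ 2] and
   to the abscissa beyond which the curve [k = k_m] of the frequency domain is available. *)
Record robin_domain (K : C -> Prop) (x0 c0 b0 : R) : Prop := {
  rd_pos : 0 < x0;
  rd_nneg : 0 <= c0;
  rd_min : forall x y, K (x, y) -> x0 <= x;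
  rd_sector : forall x y, K (x, y) -> Rabs y <= x;
  rd_conj : forall x y, K (x, y) -> K (x, - y);
  rd_attained : exists y, K (x0, y);
  rd_edge : forall x, b0 <= x -> K (x, sqrt (x ^ 2 - c0)) }.

Definition sup_le (K : C -> Prop) (lam : R) (p : C) (delta : R) : Prop :=
  forall s, K s -> robin_val lam p s <= delta.

Lemma Cmod_pair (x y : R) : Cmod (x, y) = sqrt (x ^ 2 + y ^ 2).
Proof. reflexivity. Qed.

Lemma sum_sqr_ge0 (x y : R) : 0 <= x ^ 2 + y ^ 2.
Proof. apply Rplus_le_le_0_compat; apply pow2_ge_0. Qed.

Lemma robin_val_ge0 (lam : R) (p s : C) : 0 <= robin_val lam p s.
Proof. apply Rmult_le_pos; [apply Cmod_ge_0 | left; apply exp_pos]. Qed.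

Lemma robin_val_conj (lam u v x y : R) :
  robin_val lam (u, - v) (x, y) = robin_val lam (u, v) (x, - y).
Proof.
  unfold robin_val; cbn [Re fst]. f_equal.
  rewrite <- Cmod_conj. f_equal.
  unfold Cdiv, Cminus, Cmult, Cplus, Copp, Cinv, Cconj; cbn [fst snd].
  replace (- v + y) with (- (v + - y)) by ring.
  replace ((- (v + - y)) ^ 2) with ((v + - y) ^ 2) by ring.
  f_equal; unfold Rdiv; ring.
Qed.

(** Squaring and clearing the denominator leave a polynomial inequality with one exponential factor.
    The denominator must be nonzero, because the quotient takes the default value 0 at [s = - p]. *)
Lemma robin_val_le (lam u v x y delta : R) :
  0 <= delta -> 0 < (u + x) ^ 2 + (v + y) ^ 2 ->
  robin_val lam (u, v) (x, y) <= delta <->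
  ((u - x) ^ 2 + (v - y) ^ 2) * exp (- lam * x) <=
  delta ^ 2 * ((u + x) ^ 2 + (v + y) ^ 2).
Proof.
  intros Hd HD. unfold robin_val; cbn [Re fst].
  assert (Hne : ((u, v) + (x, y))%C <> 0).
  { intros H. assert (H1 := f_equal fst H). assert (H2 := f_equal snd H).
    cbn in H1, H2. rewrite H1, H2 in HD. lra. }
  rewrite Cmod_div by exact Hne.
  change ((u, v) - (x, y))%C with ((u - x, v - y) : C).
  change ((u, v) + (x, y))%C with ((u + x, v + y) : C).
  rewrite !Cmod_pair.
  set (N := (u - x) ^ 2 + (v - y) ^ 2). set (D := (u + x) ^ 2 + (v + y) ^ 2) in *.
  assert (HN : 0 <= N) by apply sum_sqr_ge0.
  assert (HsD := sqrt_lt_R0 _ HD).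
  assert (HsN := sqrt_pos N).
  assert (EN := sqrt_sqrt N HN). assert (ED := sqrt_sqrt D (Rlt_le _ _ HD)).
  replace (- lam * x) with (- lam / 2 * x + - lam / 2 * x) by field.
  rewrite exp_plus. assert (He := exp_pos (- lam / 2 * x)).
  set (e := exp _) in *. clearbody e. clearbody N D.
  replace (sqrt N / sqrt D * e) with ((sqrt N * e) / sqrt D) by (field; lra).
  rewrite Rle_div_l by exact HsD.
  split; intros H.
  - replace (N * (e * e)) with ((sqrt N * e) ^ 2) by (rewrite <- EN at 2; ring).
    replace (delta ^ 2 * D) with ((delta * sqrt D) ^ 2) by (rewrite <- ED at 2; ring).
    apply pow_incr. split; [apply Rmult_le_pos; lra | exact H].
  - apply Rsqr_incr_0; [unfold Rsqr | apply Rmult_le_pos; lra | apply Rmult_le_pos; lra].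
    replace (sqrt N * e * (sqrt N * e)) with (N * (e * e)) by (rewrite <- EN at 1; ring).
    replace (delta * sqrt D * (delta * sqrt D)) with (delta ^ 2 * D)
      by (rewrite <- ED at 1; ring).
    exact H.
Qed.

(** * The value at the scale P *)

Lemma exp_neg_le (u : R) : 0 <= u -> exp (- u) <= / (1 + u).
Proof.
  intros Hu. rewrite exp_Ropp. apply Rinv_le_contravar; [lra |].
  apply exp_ineq1_le.
Qed.

(* With [exp (- u) <= / (1 + u)], the bound [1 - D] reduces to the polynomial
   inequality [key]. Small [x] is handled by [x0 <= x], large [x] by AM-GM:
   [4 P (1 - eps) x + 2 lam (1 - D) x ^ 3 >= 2 D x ^ 2]. *)
Lemma sup_le_at_P (K : C -> Prop) (x0 c0 b0 lam P eps : R) :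
  robin_domain K x0 c0 b0 -> 0 < eps < 1 -> 0 < P -> lam * P ^ 3 = 2 * x0 ^ 2 ->
  4 * x0 <= eps ^ 2 / 2 * P ->
  sup_le K lam (RtoC P) (sqrt (1 - 4 * x0 / P * (1 - eps))).
Proof.
  intros HK He HP Hlam Hbig [x y] Hs.
  assert (Hx0 := rd_pos _ _ _ _ HK). assert (Hx := rd_min _ _ _ _ HK _ _ Hs).
  assert (Hy := rd_sector _ _ _ _ HK _ _ Hs).
  assert (Hy2 : y ^ 2 <= x ^ 2).
  { rewrite <- (pow2_abs y). apply pow_incr. split; [apply Rabs_pos | exact Hy]. }
  assert (Hl : 0 < lam).
  { apply Rmult_lt_reg_r with (P ^ 3); [apply pow_lt; lra |]. rewrite Hlam; nra. }
  set (D := 4 * x0 / P * (1 - eps)).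
  assert (HDP : D * P = 4 * x0 * (1 - eps)) by (unfold D; field; lra).
  assert (HD0 : 0 < D).
  { apply Rmult_lt_0_compat; [apply Rdiv_lt_0_compat; lra | lra]. }
  assert (HDe : D <= eps ^ 2 / 2).
  { apply Rmult_le_reg_r with P; [lra |]. rewrite HDP. nra. }
  assert (He2 : eps ^ 2 <= eps) by nra.
  assert (HD1 : D <= 1 / 2) by lra.
  clearbody D.
  assert (key : D * (P ^ 2 + 2 * P * x + 2 * x ^ 2) <=
                4 * P * x + lam * (1 - D) * x * (P ^ 2 + 2 * P * x + 2 * x ^ 2)).
  { destruct (Rle_dec x (eps / 4 * P)) as [Hc | Hc].
    - apply Rle_trans with (4 * P * x).
      + assert (E1 : D * P <= 4 * x * (1 - eps)) by nra.
        assert (E2 : P ^ 2 + 2 * P * x + 2 * x ^ 2 <= P ^ 2 * (1 + eps)).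
        { assert (x * P <= eps / 4 * P * P) by nra.
          assert (x * x <= eps / 4 * P * P) by nra. nra. }
        apply Rle_trans with (D * (P ^ 2 * (1 + eps))).
        * apply Rmult_le_compat_l; lra.
        * replace (D * (P ^ 2 * (1 + eps))) with (D * P * (P * (1 + eps))) by ring.
          apply Rle_trans with (4 * x * (1 - eps) * (P * (1 + eps))).
          -- apply Rmult_le_compat_r; [nra | exact E1].
          -- assert (0 < x * P) by nra. nra.
      + assert (0 <= lam * (1 - D) * x * (P ^ 2 + 2 * P * x + 2 * x ^ 2)); [| lra].
        assert (0 < x * P) by nra.
        apply Rmult_le_pos; [apply Rmult_le_pos; [apply Rmult_le_pos |] |]; nra.
    - assert (Hc' : eps / 4 * P < x) by lra.
      assert (E1 : D * P ^ 2 + 2 * D * P * x <= 4 * P * x * eps).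
      { assert (D * P <= 2 * eps * x) by nra.
        assert (P * (D * P) <= P * (2 * eps * x)) by (apply Rmult_le_compat_l; lra).
        assert (0 < P * x) by nra.
        assert (D * (P * x) <= eps / 2 * (P * x)) by (apply Rmult_le_compat_r; nra). nra. }
      assert (E2 : 2 * D * x ^ 2 <= 4 * P * x * (1 - eps) + 2 * lam * (1 - D) * x ^ 3).
      { assert (Hm : 2 * D * x <= 4 * P * (1 - eps) + 2 * lam * (1 - D) * x ^ 2).
        { apply Rle_trans with (4 * P * (1 - eps) + 2 * lam * (1 - eps) * x ^ 2).
          - apply Rmult_le_reg_r with (P ^ 3); [apply pow_lt; lra |].
            replace ((4 * P * (1 - eps) + 2 * lam * (1 - eps) * x ^ 2) * P ^ 3) with
              ((1 - eps) * (4 * P ^ 4 + 2 * (lam * P ^ 3) * x ^ 2)) by ring.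
            replace (2 * D * x * P ^ 3) with (2 * (D * P) * x * P ^ 2) by ring.
            rewrite HDP, Hlam.
            assert (0 <= (1 - eps) * (2 * P ^ 2 - 2 * x0 * x) ^ 2)
              by (apply Rmult_le_pos; [lra | apply pow2_ge_0]).
            nra.
          - assert (0 <= lam * x ^ 2) by nra. nra. }
        assert (0 < x) by lra. nra. }
      assert (0 <= lam * (1 - D) * x * (P ^ 2 + 2 * P * x)).
      { assert (0 < P * x) by nra.
        apply Rmult_le_pos; [apply Rmult_le_pos; [apply Rmult_le_pos |] |]; nra. }
      nra. }
  unfold RtoC. apply robin_val_le; [apply sqrt_pos | nra |].
  rewrite pow2_sqrt by lra.
  replace (- lam * x) with (- (lam * x)) by ring.
  assert (Hlx : 0 <= lam * x) by nra.
  apply Rle_trans with (((P - x) ^ 2 + (0 - y) ^ 2) * / (1 + lam * x)).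
  { apply Rmult_le_compat_l; [apply sum_sqr_ge0 | apply exp_neg_le; exact Hlx]. }
  apply Rmult_le_reg_r with (1 + lam * x); [lra |].
  rewrite Rmult_assoc, Rinv_l, Rmult_1_r by lra.
  (* The difference of both sides is affine in [y ^ 2], with slope [lam x (1 - D) - D]. *)
  destruct (Rle_dec D (lam * x * (1 - D))) as [Hs1 | Hs1].
  - assert (0 <= (lam * x * (1 - D) - D) * ((P + x) ^ 2 + (0 + y) ^ 2)).
    { apply Rmult_le_pos; [lra | apply sum_sqr_ge0]. }
    assert (0 < P * x) by nra. nra.
  (* For a negative slope the worst case is [y ^ 2 = x ^ 2], where the inequality is [key]. *)
  - assert (0 <= (D - lam * x * (1 - D)) * (x ^ 2 - y ^ 2)).
    { apply Rmult_le_pos; lra. }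
    nra.
Qed.

Lemma exp_le_mono (x y : R) : x <= y -> exp x <= exp y.
Proof. intros [H| ->]; [left; now apply exp_increasing | right; reflexivity]. Qed.

(** * Sector and midpoint estimates *)

(** The exponential factor is traded for the constant [m]; for [m < 1] the conclusion places [p] in
    an Apollonius disc. *)
Lemma robin_val_apollonius (lam u v x y delta m : R) :
  0 <= delta -> 0 < (u + x) ^ 2 + (v + y) ^ 2 -> delta ^ 2 <= m * exp (- lam * x) ->
  robin_val lam (u, v) (x, y) <= delta ->
  (u - x) ^ 2 + (v - y) ^ 2 <= m * ((u + x) ^ 2 + (v + y) ^ 2).
Proof.
  intros Hd HD Hm H. apply robin_val_le in H; [| exact Hd | exact HD].
  apply Rmult_le_reg_r with (exp (- lam * x)); [apply exp_pos |].
  apply Rle_trans with (1 := H).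
  replace (m * ((u + x) ^ 2 + (v + y) ^ 2) * exp (- lam * x)) with
    (m * exp (- lam * x) * ((u + x) ^ 2 + (v + y) ^ 2)) by ring.
  apply Rmult_le_compat_r; lra.
Qed.

(** Both vectors are within [pi / 4] of the positive real axis, so they enclose at most a right
    angle. *)
Lemma sector_product (x y x' y' : R) :
  Rabs y <= x -> Rabs y' <= x' -> 0 <= x * x' + y * y'.
Proof.
  intros H H'. apply Rabs_le_between in H. apply Rabs_le_between in H'. nra.
Qed.

Lemma sum_sqr_gt0 (x y : R) : x <> 0 \/ y <> 0 -> 0 < x ^ 2 + y ^ 2.
Proof.
  intros [H | H]; [apply Rplus_lt_le_0_compat | apply Rplus_le_lt_0_compat];
    solve [apply pow2_ge_0 | apply pow2_gt_0; exact H].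
Qed.

(** For [p = - s] with [s] in the sector, [|p - s'| = |s + s'| >= |s' - s| = |p + s'|] by
    [sector_product], so the quotient at the other point [s'] has modulus at least 1. *)
Lemma robin_val_opposite (lam x y x' y' delta m : R) :
  Rabs y <= x -> Rabs y' <= x' -> x' - x <> 0 \/ y' - y <> 0 ->
  0 <= delta -> m < 1 -> delta ^ 2 <= m * exp (- lam * x') ->
  ~ robin_val lam (- x, - y) (x', y') <= delta.
Proof.
  intros Hs Hs' Hne Hd Hm1 Hm H.
  assert (HD := sum_sqr_gt0 _ _ Hne).
  replace (x' - x) with (- x + x') in HD by ring.
  replace (y' - y) with (- y + y') in HD by ring.
  assert (Hap := robin_val_apollonius _ _ _ _ _ _ _ Hd HD Hm H).
  assert (Hp := sector_product _ _ _ _ Hs Hs').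
  assert (Hlt : m * ((- x + x') ^ 2 + (- y + y') ^ 2) <
                1 * ((- x + x') ^ 2 + (- y + y') ^ 2))
    by (apply Rmult_lt_compat_r; lra).
  lra.
Qed.

(** Expanding the squares gives [d * S <= 2 * (2 - d) * R0]; hence [R0 >= 0], and the factor may be
    rounded up to 4. *)
Lemma apollonius_form (u v x y d : R) :
  0 <= d <= 1 ->
  (u - x) ^ 2 + (v - y) ^ 2 <= (1 - d) * ((u + x) ^ 2 + (v + y) ^ 2) ->
  d * (u ^ 2 + v ^ 2 + (x ^ 2 + y ^ 2)) <= 4 * (u * x + v * y).
Proof.
  intros Hd H.
  assert (H0 := sum_sqr_ge0 u v). assert (H1 := sum_sqr_ge0 x y).
  set (S := u ^ 2 + v ^ 2 + (x ^ 2 + y ^ 2)). set (R0 := u * x + v * y).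
  assert (H2 : d * S <= 2 * (2 - d) * R0) by (unfold S, R0; lra).
  assert (H3 : 0 <= d * S) by (apply Rmult_le_pos; unfold S; lra).
  assert (0 <= R0) by nra. nra.
Qed.

(* The smallness condition on the overlap, expressed through the scale [P]. *)
Record large_P (x0 c0 b0 lam P : R) : Prop := {
  lp_scale : lam * P ^ 3 = 2 * x0 ^ 2;
  lp_x0 : 32 * x0 <= P;
  lp_b0 : 4 * x0 * b0 <= P ^ 2;
  lp_c0 : 4096 * c0 * x0 ^ 2 <= P ^ 4 }.

Lemma sqrt_sub_ge (x c : R) : 0 < x -> 0 <= c <= x ^ 2 -> x - c / x <= sqrt (x ^ 2 - c).
Proof.
  intros Hx Hc. apply Rsqr_incr_0_var; [| apply sqrt_pos].
  rewrite Rsqr_sqrt by lra. unfold Rsqr.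
  assert (Hq : c / x * x = c) by (field; lra).
  assert (0 <= c / x) by (apply Rdiv_le_0_compat; lra).
  assert (c / x <= x) by (apply Rmult_le_reg_r with x; [lra | nra]).
  nra.
Qed.

(* Tested at the points with real parts [x0] and [P ^ 2 / (4 x0)]; at the latter the slope of
   [K] is so close to 1 that the disc condition confines [p] to the sector. A point [s = - p],
   where division by zero makes [robin_val] vanish, is excluded by [robin_val_opposite]. *)
Lemma sup_le_sector (K : C -> Prop) (x0 c0 b0 lam P u v delta : R) :
  robin_domain K x0 c0 b0 -> large_P x0 c0 b0 lam P ->
  0 <= delta -> delta ^ 2 <= 1 - 2 * x0 / P -> sup_le K lam (u, v) delta ->
  Rabs v + P / 32 <= u <= 8 * P.
Proof.
  intros HK [Hlam HP1 HPb HPc] Hd0 Hd HF.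
  assert (Hx0 := rd_pos _ _ _ _ HK). assert (Hc0 := rd_nneg _ _ _ _ HK).
  assert (HP : 0 < P) by lra.
  set (xB := P ^ 2 / (4 * x0)).
  assert (EB : xB * (4 * x0) = P ^ 2) by (unfold xB; field; lra).
  assert (HxB : x0 < xB).
  { apply Rmult_lt_reg_r with (4 * x0); [lra |]. rewrite EB. nra. }
  assert (HbB : b0 <= xB).
  { apply Rmult_le_reg_r with (4 * x0); [lra |]. rewrite EB. lra. }
  assert (HcB : 256 * c0 <= xB ^ 2).
  { apply Rmult_le_reg_r with (16 * x0 ^ 2); [nra |].
    replace (xB ^ 2 * (16 * x0 ^ 2)) with ((xB * (4 * x0)) ^ 2) by ring.
    rewrite EB. lra. }
  assert (HxB2 : 0 < xB ^ 2) by (apply pow_lt; lra).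
  set (yB := sqrt (xB ^ 2 - c0)).
  assert (HyB : 0 < yB) by (apply sqrt_lt_R0; lra).
  assert (HsB : K (xB, yB)) by (apply (rd_edge _ _ _ _ HK); exact HbB).
  assert (HsB' := rd_conj _ _ _ _ HK _ _ HsB).
  destruct (rd_attained _ _ _ _ HK) as [y0 Hs0].
  assert (Q0 := rd_sector _ _ _ _ HK _ _ Hs0).
  assert (QB := rd_sector _ _ _ _ HK _ _ HsB).
  assert (QB' := rd_sector _ _ _ _ HK _ _ HsB').
  set (d := x0 / P).
  assert (Ed : d * P = x0) by (unfold d; field; lra).
  assert (Hd1 : 0 < d) by (apply Rdiv_lt_0_compat; lra).
  assert (Hd2 : d <= 1 / 32) by (apply Rmult_le_reg_r with P; lra).
  assert (Hdd : delta ^ 2 <= 1 - 2 * d) by (unfold d; lra).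
  (* At [xB] one has [lam * xB = d / 2], so the exponential uses up at most [d / 2] of the gap
     [2 * d], and a gap [d] is left for the disc condition. *)
  assert (Hexp : forall x, 0 < x <= xB -> delta ^ 2 <= (1 - d) * exp (- lam * x)).
  { intros x Hx.
    assert (Hl : lam * x <= d / 2).
    { assert (0 < lam).
      { apply Rmult_lt_reg_r with (P ^ 3); [apply pow_lt; lra |]. rewrite Hlam. nra. }
      apply Rle_trans with (lam * xB); [apply Rmult_le_compat_l; lra |].
      apply Rmult_le_reg_r with (4 * x0 * P); [nra |].
      replace (lam * xB * (4 * x0 * P)) with (lam * (xB * (4 * x0)) * P) by ring.
      rewrite EB. replace (lam * P ^ 2 * P) with (lam * P ^ 3) by ring.
      rewrite Hlam. replace (d / 2 * (4 * x0 * P)) with (2 * x0 * (d * P)) by field.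
      rewrite Ed. lra. }
    assert (He : 1 - d / 2 <= exp (- lam * x)).
    { apply Rle_trans with (1 + - lam * x); [lra | apply exp_ineq1_le]. }
    nra. }
  assert (Hnd : forall x y, K (x, y) -> x <= xB -> 0 < (u + x) ^ 2 + (v + y) ^ 2).
  { intros x y Hs Hx. apply sum_sqr_gt0.
    destruct (Req_dec (u + x) 0) as [E1 | N1]; [| left; exact N1].
    destruct (Req_dec (v + y) 0) as [E2 | N2]; [| right; exact N2].
    exfalso.
    assert (Eu : u = - x) by lra. assert (Ev : v = - y) by lra. subst u v.
    assert (Q := rd_sector _ _ _ _ HK _ _ Hs).
    (* The second test point has to differ from [s]; if [s] has ordinate [yB], the conjugate point
       serves. *)
    destruct (Req_dec y yB) as [Ey | Ny].
    - refine (robin_val_opposite lam x y xB (- yB) delta (1 - d) Q QB' _ Hd0 _ _ _);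
        [right; lra | lra | apply Hexp; lra | apply HF; exact HsB'].
    - refine (robin_val_opposite lam x y xB yB delta (1 - d) Q QB _ Hd0 _ _ _);
        [right; lra | lra | apply Hexp; lra | apply HF; exact HsB]. }
  assert (Hform : forall x y, K (x, y) -> x <= xB ->
            d * (u ^ 2 + v ^ 2 + (x ^ 2 + y ^ 2)) <= 4 * (u * x + v * y)).
  { intros x y Hs Hx. assert (Hm := rd_min _ _ _ _ HK _ _ Hs).
    apply apollonius_form; [lra |].
    apply robin_val_apollonius with lam delta;
      [exact Hd0 | apply Hnd; assumption | apply Hexp; lra | apply HF; exact Hs]. }
  (* The test point of real part [x0] bounds the size of [p]: it yields
     [U ^ 2 + V ^ 2 <= 4 P (U + V)], and [(U + V) ^ 2 <= 2 (U ^ 2 + V ^ 2)]. *)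
  assert (Hsum : Rabs u + Rabs v <= 8 * P).
  { assert (H0 := Hform _ _ Hs0 (Rlt_le _ _ HxB)).
    assert (B1 : u * x0 <= Rabs u * x0)
      by (apply Rmult_le_compat_r; [lra | apply Rle_abs]).
    assert (B2 : v * y0 <= Rabs v * x0).
    { apply Rle_trans with (Rabs (v * y0)); [apply Rle_abs |].
      rewrite Rabs_mult. apply Rmult_le_compat_l; [apply Rabs_pos | exact Q0]. }
    assert (B3 := pow2_abs u). assert (B4 := pow2_abs v).
    assert (Pu := Rabs_pos u). assert (Pv := Rabs_pos v).
    set (U := Rabs u) in *. set (V := Rabs v) in *.
    assert (Hx0y0 := sum_sqr_ge0 x0 y0).
    assert (B5 : d * (U ^ 2 + V ^ 2) <= 4 * (d * P) * (U + V)).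
    { rewrite Ed. assert (0 <= d * (x0 ^ 2 + y0 ^ 2)) by (apply Rmult_le_pos; lra). nra. }
    assert (B6 : U ^ 2 + V ^ 2 <= 4 * P * (U + V)).
    { apply Rmult_le_reg_l with d; lra. }
    destruct (Rle_dec (U + V) (8 * P)) as [|n]; [assumption |].
    assert (0 <= (U - V) ^ 2) by apply pow2_ge_0. nra. }
  assert (HB : d * xB ^ 2 <= 4 * (u * xB - Rabs v * yB)).
  { assert (H1 := Hform _ _ HsB (Rle_refl _)). assert (H2 := Hform _ _ HsB' (Rle_refl _)).
    assert (Hr : 0 <= d * (u ^ 2 + v ^ 2 + yB ^ 2)).
    { assert (G := sum_sqr_ge0 u v). assert (G' := pow2_ge_0 yB).
      apply Rmult_le_pos; lra. }
    unfold Rabs; destruct (Rcase_abs v); lra. }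
  assert (Hy := sqrt_sub_ge xB c0 ltac:(lra) ltac:(lra)). fold yB in Hy.
  assert (Pu := Rle_abs u). assert (Pv := Rabs_pos v).
  assert (Pu' := Rabs_pos u).
  split; [| lra].
  (* [HB] and [F2] amount to [u xB - |v| yB >= P xB / 16]; replacing [yB] by [xB] costs at most
     [P xB / 32], which leaves the margin [P / 32]. *)
  assert (F1 : Rabs v * (xB - yB) <= 8 * P * (c0 / xB)).
  { apply Rle_trans with (Rabs v * (c0 / xB)).
    - apply Rmult_le_compat_l; lra.
    - apply Rmult_le_compat_r; [apply Rdiv_le_0_compat; lra | lra]. }
  assert (F2 : d * xB ^ 2 = P / 4 * xB).
  { replace (d * xB ^ 2) with (d * (xB * (4 * x0)) * xB / (4 * x0)) by (field; lra).
    rewrite EB. replace (d * P ^ 2) with (d * P * P) by ring. rewrite Ed. field. lra. }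
  assert (F3 : 8 * P * (c0 / xB) <= P / 32 * xB).
  { replace (8 * P * (c0 / xB)) with (P / 32 * (256 * c0 / xB)) by (field; lra).
    apply Rmult_le_compat_l; [lra |].
    apply Rle_div_l; [lra |]. nra. }
  apply Rmult_le_reg_r with xB; [lra |]. nra.
Qed.

(** The gain must be uniform over the unbounded set [K]. Beyond [X2] the exponential alone brings
    the squared value below [delta ^ 2 / 2]. Up to [X2], [|p + s| ^ 2] is at most [H], and the
    parallelogram identity supplies the gain [eta], a quarter of the squared distance of the two
    parameters. *)
Lemma midpoint_improves (K : C -> Prop) (x0 c0 b0 lam mu delta u1 v1 u2 v2 : R) :
  robin_domain K x0 c0 b0 -> 0 < lam -> 0 < mu -> 0 < delta ->
  Rabs v1 + mu <= u1 -> Rabs v2 + mu <= u2 -> u1 - u2 <> 0 \/ v1 - v2 <> 0 ->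
  sup_le K lam (u1, v1) delta -> sup_le K lam (u2, v2) delta ->
  exists delta', 0 <= delta' < delta /\ sup_le K lam ((u1 + u2) / 2, (v1 + v2) / 2) delta'.
Proof.
  intros HK Hlam Hmu Hd H1 H2 Hne F1 F2.
  assert (Hx0 := rd_pos _ _ _ _ HK).
  set (um := (u1 + u2) / 2). set (vm := (v1 + v2) / 2).
  assert (Hm : Rabs vm + mu <= um).
  { assert (G := Rabs_triang v1 v2). unfold vm, um, Rdiv.
    rewrite Rabs_mult, (Rabs_pos_eq (/ 2)) by lra. lra. }
  set (eta := ((u1 - u2) ^ 2 + (v1 - v2) ^ 2) / 4).
  assert (Heta : 0 < eta).
  { apply Rdiv_lt_0_compat; [apply sum_sqr_gt0; exact Hne | lra]. }
  assert (Hd2 : 0 < delta ^ 2) by (apply pow_lt; lra).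
  set (X2 := Rmax x0 (- ln (delta ^ 2 / 2) / lam)).
  assert (HX2 : 0 < X2) by (apply Rlt_le_trans with x0; [lra | apply Rmax_l]).
  assert (EX2 : exp (- lam * X2) <= delta ^ 2 / 2).
  { rewrite <- (exp_ln (delta ^ 2 / 2)) by lra. apply exp_le_mono.
    assert (G : - ln (delta ^ 2 / 2) / lam <= X2) by apply Rmax_r.
    apply Rle_div_l in G; lra. }
  set (H := (um + X2) ^ 2 + (Rabs vm + X2) ^ 2).
  assert (Pvm := Rabs_pos vm).
  assert (HH : 0 < H) by (apply sum_sqr_gt0; left; lra).
  (* [g] is at most [2 mu x0], for the case of small [tau], and at most [2 mu x0 eta / H], for the
     case where [tau] is bounded below and the gain is [tau * eta]. *)
  set (g := 2 * mu * x0 * (eta / (H + eta))).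
  assert (Hq0 : 0 < eta / (H + eta)) by (apply Rdiv_lt_0_compat; lra).
  assert (Hmx : 0 < mu * x0) by (apply Rmult_lt_0_compat; lra).
  assert (Hg : 0 < g) by (apply Rmult_lt_0_compat; lra).
  assert (Hg1 : g <= 2 * mu * x0).
  { unfold g. assert (eta / (H + eta) <= 1) by (apply Rle_div_l; lra). nra. }
  assert (Hg2 : g * H <= 2 * mu * x0 * eta).
  { unfold g. replace (2 * mu * x0 * (eta / (H + eta)) * H) with
      (2 * mu * x0 * eta * (H / (H + eta))) by (field; lra).
    assert (H / (H + eta) <= 1) by (apply Rle_div_l; lra).
    assert (0 < mu * x0 * eta) by (apply Rmult_lt_0_compat; lra). nra. }
  set (gap := g * exp (- lam * X2) / H).
  assert (Hgap : 0 < gap).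
  { apply Rdiv_lt_0_compat; [apply Rmult_lt_0_compat; [lra | apply exp_pos] | lra]. }
  set (D2 := Rmax (delta ^ 2 / 2) (delta ^ 2 - gap)).
  assert (HD2 : delta ^ 2 / 2 <= D2) by apply Rmax_l.
  assert (HD2' : delta ^ 2 - gap <= D2) by apply Rmax_r.
  assert (HD2'' : D2 < delta ^ 2) by (apply Rmax_lub_lt; lra).
  exists (sqrt D2). split.
  { split; [apply sqrt_pos |]. rewrite <- (sqrt_pow2 delta) by lra.
    apply sqrt_lt_1; lra. }
  intros [x y] Hs.
  assert (Hx := rd_min _ _ _ _ HK _ _ Hs). assert (Hy := rd_sector _ _ _ _ HK _ _ Hs).
  assert (P1 := Rabs_pos v1). assert (P2 := Rabs_pos v2).
  assert (Hnd1 : 0 < (u1 + x) ^ 2 + (v1 + y) ^ 2) by (apply sum_sqr_gt0; left; lra).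
  assert (Hnd2 : 0 < (u2 + x) ^ 2 + (v2 + y) ^ 2) by (apply sum_sqr_gt0; left; lra).
  assert (Hndm : 0 < (um + x) ^ 2 + (vm + y) ^ 2) by (apply sum_sqr_gt0; left; lra).
  assert (HR : mu * x <= um * x + vm * y).
  { assert (G : 0 <= (um - mu) * x + vm * y) by (apply sector_product; lra). lra. }
  apply robin_val_le; [apply sqrt_pos | exact Hndm |].
  rewrite pow2_sqrt by lra.
  set (Dn := (um + x) ^ 2 + (vm + y) ^ 2) in *.
  assert (EN : (um - x) ^ 2 + (vm - y) ^ 2 = Dn - 4 * (um * x + vm * y))
    by (unfold Dn; ring).
  rewrite EN.
  assert (Hexp := exp_pos (- lam * x)).
  destruct (Rle_dec X2 x) as [Hc | Hc].
  - apply Rle_trans with (Dn * exp (- lam * x)).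
    { apply Rmult_le_compat_r; [lra |]. nra. }
    rewrite Rmult_comm. apply Rmult_le_compat_r; [lra |].
    apply Rle_trans with (2 := HD2). apply Rle_trans with (2 := EX2).
    apply exp_le_mono. nra.
  - assert (HDnH : Dn <= H).
    { unfold Dn, H. apply Rplus_le_compat; [apply pow_incr; lra |].
      rewrite <- (pow2_abs (vm + y)). apply pow_incr. split; [apply Rabs_pos |].
      apply Rle_trans with (1 := Rabs_triang _ _). lra. }
    (* [tau |p + s| ^ 2 <= 4 Re (p s^* )] is the disc condition; for [tau > 0] it is strictly
       convex in [p], and for [tau] close to 0 the sector gives the strict inequality. *)
    set (tau := 1 - delta ^ 2 * exp (lam * x)).
    assert (Eexp : exp (lam * x) * exp (- lam * x) = 1).
    { rewrite <- exp_plus. replace (lam * x + - lam * x) with 0 by ring. apply exp_0. }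
    assert (Etau : delta ^ 2 = (1 - tau) * exp (- lam * x)).
    { unfold tau. replace ((1 - (1 - delta ^ 2 * exp (lam * x))) * exp (- lam * x)) with
        (delta ^ 2 * (exp (lam * x) * exp (- lam * x))) by ring. rewrite Eexp. ring. }
    assert (A1 := robin_val_apollonius lam u1 v1 x y delta (1 - tau) (Rlt_le _ _ Hd) Hnd1
                    (Req_le _ _ Etau) (F1 _ Hs)).
    assert (A2 := robin_val_apollonius lam u2 v2 x y delta (1 - tau) (Rlt_le _ _ Hd) Hnd2
                    (Req_le _ _ Etau) (F2 _ Hs)).
    assert (Am : tau * (Dn + eta) <= 4 * (um * x + vm * y)).
    { replace (tau * (Dn + eta)) with
        (tau * ((u1 + x) ^ 2 + (v1 + y) ^ 2) / 2 + tau * ((u2 + x) ^ 2 + (v2 + y) ^ 2) / 2)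
        by (unfold Dn, eta, um, vm; field).
      replace (4 * (um * x + vm * y)) with
        (2 * (u1 * x + v1 * y) + 2 * (u2 * x + v2 * y)) by (unfold um, vm; field).
      lra. }
    assert (Hgg : tau * Dn + g <= 4 * (um * x + vm * y)).
    { assert (Hmx' : mu * x0 <= mu * x) by (apply Rmult_le_compat_l; lra).
      destruct (Rle_dec (tau * Dn) (2 * mu * x0)) as [Ht | Ht]; [lra |].
      assert (Htau : 0 < tau) by (apply Rmult_lt_reg_r with Dn; lra).
      assert (g <= tau * eta); [| lra].
      apply Rmult_le_reg_r with H; [lra |].
      apply Rle_trans with (1 := Hg2).
      assert (tau * Dn <= tau * H) by (apply Rmult_le_compat_l; lra). nra. }
    apply Rle_trans with ((delta ^ 2 - gap) * Dn); [| apply Rmult_le_compat_r; lra].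
    assert (Hgap2 : gap * Dn <= g * exp (- lam * x)).
    { apply Rle_trans with (gap * H); [apply Rmult_le_compat_l; lra |].
      unfold gap. replace (g * exp (- lam * X2) / H * H) with (g * exp (- lam * X2))
        by (field; lra).
      apply Rmult_le_compat_l; [lra |]. apply exp_le_mono. nra. }
    rewrite Etau at 1.
    assert (Hf : (Dn - 4 * (um * x + vm * y)) * exp (- lam * x) <=
                 ((1 - tau) * Dn - g) * exp (- lam * x))
      by (apply Rmult_le_compat_r; lra).
    lra.
Qed.

(** * Existence and uniqueness *)

Definition ksup (K : C -> Prop) (lam : R) (p : C) : Rbar :=
  Lub_Rbar (fun r => exists s, K s /\ r = robin_val lam p s).

Lemma ksup_le_iff (K : C -> Prop) (lam : R) (p : C) (delta : R) :
  Rbar_le (ksup K lam p) delta <-> sup_le K lam p delta.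
Proof.
  unfold ksup. destruct (Lub_Rbar_correct (fun r => exists s, K s /\ r = robin_val lam p s))
    as [Hub Hlub].
  split; intros H.
  - intros s Hs. change (Rbar_le (robin_val lam p s) delta).
    apply Rbar_le_trans with (2 := H). apply Hub. exists s; auto.
  - apply Hlub. intros r [s [Hs ->]]. exact (H s Hs).
Qed.

Lemma ksup_ge (K : C -> Prop) (lam : R) (p s : C) :
  K s -> Rbar_le (robin_val lam p s) (ksup K lam p).
Proof.
  intros Hs. apply (proj1 (Lub_Rbar_correct _)). exists s; auto.
Qed.

Definition best (K : C -> Prop) (lam : R) (p : C) (delta : R) : Prop :=
  sup_le K lam p delta /\ forall p' delta', sup_le K lam p' delta' -> delta <= delta'.

(** A point of [K] rules out the value [m_infty], the supremum of the empty set. *)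
Lemma best_iff (K : C -> Prop) (lam : R) (p : C) (delta : R) :
  (exists s, K s) ->
  (ksup K lam p = Finite delta /\ forall p', Rbar_le delta (ksup K lam p')) <->
  best K lam p delta.
Proof.
  intros [s Hs]. split.
  - intros [E Hmin]. split.
    + apply ksup_le_iff. rewrite E. apply Rbar_le_refl.
    + intros p' delta' H. apply ksup_le_iff in H.
      exact (Rbar_le_trans _ _ _ (Hmin p') H).
  - intros [H Hmin].
    assert (Hge : forall p', Rbar_le delta (ksup K lam p')).
    { intros p'. assert (G := ksup_ge K lam p' s Hs).
      destruct (ksup K lam p') as [r | |] eqn:E; [| exact I | exact G].
      apply (Hmin p'). apply ksup_le_iff. rewrite E. apply Rbar_le_refl. }
    split; [| exact Hge].
    apply Rbar_le_antisym; [apply ksup_le_iff; exact H | apply Hge].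
Qed.

Lemma sup_le_conj (K : C -> Prop) (x0 c0 b0 lam u v delta : R) :
  robin_domain K x0 c0 b0 -> sup_le K lam (u, v) delta -> sup_le K lam (u, - v) delta.
Proof.
  intros HK H [x y] Hs. rewrite robin_val_conj. apply H.
  apply (rd_conj _ _ _ _ HK). exact Hs.
Qed.

(** A bound at most 0 would force [p = s] both at an edge point of nonzero ordinate and at its
    conjugate. *)
Lemma sup_le_gt0 (K : C -> Prop) (x0 c0 b0 lam u v delta : R) :
  robin_domain K x0 c0 b0 -> 0 < u -> sup_le K lam (u, v) delta -> 0 < delta.
Proof.
  intros HK Hu H.
  assert (Hc0 := rd_nneg _ _ _ _ HK). assert (Hx0 := rd_pos _ _ _ _ HK).
  set (x := Rmax b0 (c0 + 1)).
  assert (Hxb : b0 <= x) by apply Rmax_l. assert (Hxc : c0 + 1 <= x) by apply Rmax_r.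
  assert (Hs := rd_edge _ _ _ _ HK x Hxb).
  assert (Hy : 0 < sqrt (x ^ 2 - c0)) by (apply sqrt_lt_R0; nra).
  set (y := sqrt _) in *.
  assert (Hs' := rd_conj _ _ _ _ HK _ _ Hs).
  destruct (Rlt_dec 0 delta) as [|n]; [assumption | exfalso].
  assert (Z : forall y', K (x, y') -> v - y' = 0).
  { intros y' Hk. assert (G := H _ Hk).
    assert (Hle : robin_val lam (u, v) (x, y') <= 0) by lra.
    apply robin_val_le in Hle; [| lra | apply sum_sqr_gt0; left; lra].
    assert (He := exp_pos (- lam * x)).
    destruct (Req_dec (v - y') 0) as [|N]; [assumption | exfalso].
    assert (G1 : 0 < (u - x) ^ 2 + (v - y') ^ 2) by (apply sum_sqr_gt0; right; exact N).
    assert (0 < ((u - x) ^ 2 + (v - y') ^ 2) * exp (- lam * x))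
      by (apply Rmult_lt_0_compat; assumption).
    lra. }
  assert (Z1 := Z _ Hs). assert (Z2 := Z _ Hs'). lra.
Qed.

Lemma Re_le_Cmod (z : C) : Re z <= Cmod z.
Proof. apply Rle_trans with (1 := Rle_abs _). apply re_le_Cmod. Qed.

(** The two quotients differ by [2 s (p - q) / ((p + s) (q + s))]. As [Re s > 0], each factor of the
    denominator dominates both [|s|] and its own parameter, so the product is at least
    [|s| * Rmax p q]; the estimate is therefore uniform in [s]. *)
Lemma robin_val_lipschitz (lam p q x y : R) :
  0 <= lam -> 0 < p -> 0 < q -> 0 < x ->
  robin_val lam (RtoC p) (x, y) <= robin_val lam (RtoC q) (x, y) + 2 * Rabs (p - q) / Rmax p q.
Proof.
  intros Hlam Hp Hq Hx.
  set (s := (x, y) : C).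
  assert (Hge : forall r, 0 < r -> r <= Cmod (RtoC r + s)).
  { intros r Hr. apply Rle_trans with (2 := Re_le_Cmod _). cbn. lra. }
  assert (Hges : forall r, 0 < r -> Cmod s <= Cmod (RtoC r + s)).
  { intros r Hr. unfold Cmod; cbn [fst snd s RtoC Cplus]. apply sqrt_le_1_alt.
    rewrite Rplus_0_l. apply Rplus_le_compat_r. apply pow_incr. lra. }
  assert (Hs0 : 0 < Cmod s).
  { apply Rlt_le_trans with (2 := Re_le_Cmod _). exact Hx. }
  assert (Np : (RtoC p + s)%C <> 0) by (apply Cmod_gt_0; specialize (Hge p Hp); lra).
  assert (Nq : (RtoC q + s)%C <> 0) by (apply Cmod_gt_0; specialize (Hge q Hq); lra).
  assert (E : ((RtoC p - s) / (RtoC p + s) =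
    (RtoC q - s) / (RtoC q + s) +
    (RtoC 2 * s * RtoC (p - q)) / ((RtoC p + s) * (RtoC q + s)))%C).
  { rewrite RtoC_minus. field. split; assumption. }
  assert (B : Cmod ((RtoC 2 * s * RtoC (p - q)) / ((RtoC p + s) * (RtoC q + s)))%C
              <= 2 * Rabs (p - q) / Rmax p q).
  { rewrite Cmod_div by (apply Cmult_neq_0; assumption).
    rewrite !Cmod_mult, !Cmod_R, (Rabs_pos_eq 2) by lra.
    assert (Ha := Rabs_pos (p - q)).
    assert (Gp := Hge p Hp). assert (Gq := Hge q Hq).
    assert (Sp := Hges p Hp). assert (Sq := Hges q Hq).
    assert (Hm : 0 < Rmax p q) by (apply Rlt_le_trans with p; [lra | apply Rmax_l]).
    apply Rle_div_l; [apply Rmult_lt_0_compat; lra |].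
    assert (Hprod : Cmod s * Rmax p q <= Cmod (RtoC p + s) * Cmod (RtoC q + s)).
    { unfold Rmax. destruct (Rle_dec p q).
      - apply Rmult_le_compat; lra.
      - rewrite Rmult_comm. apply Rmult_le_compat; lra. }
    replace (2 * Rabs (p - q) / Rmax p q * (Cmod (RtoC p + s) * Cmod (RtoC q + s))) with
      (2 * Rabs (p - q) * ((Cmod (RtoC p + s) * Cmod (RtoC q + s)) / Rmax p q))
      by (field; lra).
    replace (2 * Cmod s * Rabs (p - q)) with (2 * Rabs (p - q) * Cmod s) by ring.
    apply Rmult_le_compat_l; [lra |]. apply Rle_div_r; lra. }
  unfold robin_val. rewrite E.
  assert (He : exp (- lam / 2 * Re s) <= 1).
  { rewrite <- exp_0. apply exp_le_mono. cbn. nra. }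
  assert (He0 := exp_pos (- lam / 2 * Re s)).
  assert (T := Cmod_triangle ((RtoC q - s) / (RtoC q + s))
    ((RtoC 2 * s * RtoC (p - q)) / ((RtoC p + s) * (RtoC q + s)))).
  set (t := Cmod (_ / (_ * _))%C) in *.
  assert (0 <= t) by apply Cmod_ge_0.
  apply Rle_trans with ((Cmod ((RtoC q - s) / (RtoC q + s)) + t) * exp (- lam / 2 * Re s)).
  - apply Rmult_le_compat_r; lra.
  - nra.
Qed.

Lemma sup_le_one (K : C -> Prop) (x0 c0 b0 lam p : R) :
  robin_domain K x0 c0 b0 -> 0 <= lam -> 0 < p -> sup_le K lam (RtoC p) 1.
Proof.
  intros HK Hlam Hp [x y] Hs.
  assert (Hx := rd_min _ _ _ _ HK _ _ Hs). assert (Hx0 := rd_pos _ _ _ _ HK).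
  unfold RtoC. apply robin_val_le; [lra | apply sum_sqr_gt0; left; lra |].
  assert (He : exp (- lam * x) <= 1).
  { rewrite <- exp_0. apply exp_le_mono. nra. }
  assert (G := sum_sqr_ge0 (p - x) (0 - y)).
  apply Rle_trans with (((p - x) ^ 2 + (0 - y) ^ 2) * 1).
  - apply Rmult_le_compat_l; assumption.
  - nra.
Qed.

Lemma ksup_real (K : C -> Prop) (x0 c0 b0 lam p : R) :
  robin_domain K x0 c0 b0 -> 0 <= lam -> 0 < p ->
  ksup K lam (RtoC p) = Finite (real (ksup K lam (RtoC p))).
Proof.
  intros HK Hlam Hp.
  assert (H1 := sup_le_one K x0 c0 b0 lam p HK Hlam Hp). apply ksup_le_iff in H1.
  destruct (rd_attained _ _ _ _ HK) as [y Hs].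
  assert (H2 := ksup_ge K lam (RtoC p) _ Hs).
  destruct (ksup K lam (RtoC p)); [reflexivity | contradiction | contradiction].
Qed.

Lemma ksup_continuous (K : C -> Prop) (x0 c0 b0 lam p : R) :
  robin_domain K x0 c0 b0 -> 0 <= lam -> 0 < p ->
  continuity_pt (fun q => real (ksup K lam (RtoC q))) p.
Proof.
  intros HK Hlam Hp. assert (Hx0 := rd_pos _ _ _ _ HK).
  (* Because of the maximum in the denominator, the constant [2 / p] is valid whichever of the two
     arguments equals [p]. *)
  assert (Hlip : forall q r, 0 < q -> 0 < r -> p <= Rmax q r ->
    real (ksup K lam (RtoC q)) <= real (ksup K lam (RtoC r)) + 2 * Rabs (q - r) / p).
  { intros q r Hq Hr Hm.
    change (Rbar_le (real (ksup K lam (RtoC q)))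
      (real (ksup K lam (RtoC r)) + 2 * Rabs (q - r) / p)).
    rewrite <- (ksup_real K x0 c0 b0 lam q HK Hlam Hq).
    apply ksup_le_iff. intros [x y] Hs.
    assert (Hx := rd_min _ _ _ _ HK _ _ Hs).
    apply Rle_trans with (1 := robin_val_lipschitz lam q r x y Hlam Hq Hr ltac:(lra)).
    apply Rplus_le_compat.
    - assert (G := ksup_ge K lam (RtoC r) _ Hs).
      rewrite (ksup_real K x0 c0 b0 lam r HK Hlam Hr) in G. exact G.
    - apply Rmult_le_compat_l; [assert (G := Rabs_pos (q - r)); lra |].
      apply Rinv_le_contravar; lra. }
  intros eps Heps. exists (Rmin p (eps * p / 2)). split.
  { apply Rmin_glb_lt; [lra | apply Rdiv_lt_0_compat; nra]. }
  intros q [_ Hq]. cbn in Hq |- *. unfold R_dist in *.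
  assert (Hq1 := Rlt_le_trans _ _ _ Hq (Rmin_l _ _)).
  assert (Hq2 := Rlt_le_trans _ _ _ Hq (Rmin_r _ _)).
  assert (Hq0 : 0 < q) by (apply Rabs_lt_between in Hq1; lra).
  assert (L1 := Hlip q p Hq0 Hp (Rmax_r _ _)).
  assert (L2 := Hlip p q Hp Hq0 (Rmax_l _ _)).
  rewrite (Rabs_minus_sym p q) in L2.
  assert (B : 2 * Rabs (q - p) / p < eps) by (apply Rlt_div_l; lra).
  apply Rabs_lt_between. lra.
Qed.

Lemma sqr_le_of_le_sqrt (x y : R) : 0 <= x -> 0 <= y -> x <= sqrt y -> x ^ 2 <= y.
Proof. intros Hx Hy H. rewrite <- (pow2_sqrt y) by exact Hy. apply pow_incr. lra. Qed.

(** The choice [eps = 1 / 2] gives a level that the optimum cannot exceed and that is exactly the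
    one at which [sup_le_sector] applies. *)
Lemma sup_le_at_P_half (K : C -> Prop) (x0 c0 b0 lam P : R) :
  robin_domain K x0 c0 b0 -> large_P x0 c0 b0 lam P ->
  sup_le K lam (RtoC P) (sqrt (1 - 2 * x0 / P)).
Proof.
  intros HK [Hlam HP1 HPb HPc]. assert (Hx0 := rd_pos _ _ _ _ HK).
  replace (2 * x0 / P) with (4 * x0 / P * (1 - 1 / 2)) by (field; lra).
  apply (sup_le_at_P K x0 c0 b0); [exact HK | lra | lra | exact Hlam | lra].
Qed.

Lemma large_P_facts (x0 c0 b0 lam P : R) :
  0 < x0 -> large_P x0 c0 b0 lam P -> 0 < P /\ 0 < lam /\ 0 <= 1 - 2 * x0 / P.
Proof.
  intros Hx0 [Hlam HP1 HPb HPc].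
  assert (HP : 0 < P) by lra. split; [exact HP | split].
  - apply Rmult_lt_reg_r with (P ^ 3); [apply pow_lt; lra |]. rewrite Hlam. nra.
  - assert (2 * x0 / P <= 1) by (apply Rle_div_l; lra). lra.
Qed.

(** It suffices to minimize over the compact real interval from [P / 32] to [8 P]. A parameter above
    the level of [sup_le_at_P_half] is beaten by [P]; one below it lies in the sector, and if it is
    not real, the midpoint with its conjugate, that is its real part, is better. *)
Lemma best_exists (K : C -> Prop) (x0 c0 b0 lam P : R) :
  robin_domain K x0 c0 b0 -> large_P x0 c0 b0 lam P ->
  exists p delta, P / 32 <= p /\ best K lam (RtoC p) delta.
Proof.
  intros HK HL. assert (Hx0 := rd_pos _ _ _ _ HK).
  destruct (large_P_facts _ _ _ _ _ Hx0 HL) as [HP [Hlam Hpos]].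
  set (f := fun q => real (ksup K lam (RtoC q))).
  destruct (continuity_ab_min f (P / 32) (8 * P)) as [p [Hmin Hp]].
  { lra. }
  { intros q Hq. apply (ksup_continuous K x0 c0 b0); [exact HK | lra | lra]. }
  assert (Hf : forall q d, P / 32 <= q <= 8 * P -> sup_le K lam (RtoC q) d -> f p <= d).
  { intros q d Hq H. apply Rle_trans with (1 := Hmin q Hq).
    apply ksup_le_iff in H.
    rewrite (ksup_real K x0 c0 b0 lam q HK) in H; [exact H | lra | lra]. }
  exists p, (f p). split; [lra | split].
  - apply ksup_le_iff. unfold f. rewrite <- (ksup_real K x0 c0 b0 lam p HK); [| lra | lra].
    apply Rbar_le_refl.
  - intros [u v] d H.
    destruct (Rle_dec d (sqrt (1 - 2 * x0 / P))) as [Hd | Hd].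
    + destruct (rd_attained _ _ _ _ HK) as [y0 Hs0].
      assert (Hd0 : 0 <= d) by (apply Rle_trans with (2 := H _ Hs0); apply robin_val_ge0).
      assert (Hd2 := sqr_le_of_le_sqrt _ _ Hd0 Hpos Hd).
      destruct (sup_le_sector K x0 c0 b0 lam P u v d HK HL Hd0 Hd2 H) as [S1 S2].
      assert (Pv := Rabs_pos v).
      destruct (Req_dec v 0) as [-> | Nv].
      * apply (Hf u); [lra | exact H].
      * destruct (midpoint_improves K x0 c0 b0 lam (P / 32) d u v u (- v)) as [d' [Hd' H']].
        -- exact HK.
        -- exact Hlam.
        -- lra.
        -- apply (sup_le_gt0 K x0 c0 b0 lam u v); [exact HK | lra | exact H].
        -- lra.
        -- rewrite Rabs_Ropp. lra.
        -- right. lra.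
        -- exact H.
        -- exact (sup_le_conj K x0 c0 b0 lam u v d HK H).
        -- apply Rle_trans with d'; [| lra]. apply (Hf u); [lra |].
           replace (RtoC u) with (((u + u) / 2, (v + - v) / 2) : C); [exact H' |].
           unfold RtoC. f_equal; field.
    + apply Rle_trans with (sqrt (1 - 2 * x0 / P)); [| lra].
      apply (Hf P); [lra |]. apply (sup_le_at_P_half K x0 c0 b0); assumption.
Qed.

Lemma best_unique (K : C -> Prop) (x0 c0 b0 lam P : R) (p q : C) (delta delta' : R) :
  robin_domain K x0 c0 b0 -> large_P x0 c0 b0 lam P ->
  best K lam p delta -> best K lam q delta' -> p = q.
Proof.
  intros HK HL [Hp Mp] [Hq Mq]. assert (Hx0 := rd_pos _ _ _ _ HK).
  destruct (large_P_facts _ _ _ _ _ Hx0 HL) as [HP [Hlam Hpos]].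
  assert (E : delta' = delta).
  { apply Rle_antisym; [exact (Mq _ _ Hp) | exact (Mp _ _ Hq)]. }
  subst delta'.
  destruct (rd_attained _ _ _ _ HK) as [y0 Hs0].
  assert (Hd0 : 0 <= delta) by (apply Rle_trans with (2 := Hp _ Hs0); apply robin_val_ge0).
  assert (Hd2 := sqr_le_of_le_sqrt _ _ Hd0 Hpos
                   (Mp _ _ (sup_le_at_P_half K x0 c0 b0 lam P HK HL))).
  destruct p as [u v], q as [u' v'].
  destruct (sup_le_sector K x0 c0 b0 lam P u v delta HK HL Hd0 Hd2 Hp) as [S1 S2].
  destruct (sup_le_sector K x0 c0 b0 lam P u' v' delta HK HL Hd0 Hd2 Hq) as [S1' S2'].
  assert (Pv := Rabs_pos v).
  destruct (Req_dec (u - u') 0) as [Eu | Nu]; [destruct (Req_dec (v - v') 0) as [Ev | Nv] |].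
  { f_equal; lra. }
  all: exfalso;
    destruct (midpoint_improves K x0 c0 b0 lam (P / 32) delta u v u' v') as [d' [Hd' H']];
    try assumption; try lra; auto;
    try (apply (sup_le_gt0 K x0 c0 b0 lam u v); [exact HK | lra | exact Hp]);
    assert (G := Mp _ _ H'); lra.
Qed.

(** With [r = 4 p x / |p + s| ^ 2] the squared quotient is [1 - r], and
    [exp (- lam x) >= 1 - lam x]; in the product of these two, the term [lam x r] has the favourable
    sign. This turns each test point into a lower bound for [delta]. *)
Lemma sup_le_lower (K : C -> Prop) (x0 c0 b0 lam p delta x y : R) :
  robin_domain K x0 c0 b0 -> 0 <= lam -> 0 < p -> 0 <= delta <= 1 ->
  sup_le K lam (RtoC p) delta -> K (x, y) ->
  1 - delta ^ 2 <= lam * x + 4 * p * x / ((p + x) ^ 2 + y ^ 2).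
Proof.
  intros HK Hlam Hp Hd H Hs.
  assert (Hx := rd_min _ _ _ _ HK _ _ Hs). assert (Hx0 := rd_pos _ _ _ _ HK).
  assert (Hnd : 0 < (p + x) ^ 2 + (0 + y) ^ 2) by (apply sum_sqr_gt0; left; lra).
  assert (G := H _ Hs). unfold RtoC in G. apply robin_val_le in G; [| lra | exact Hnd].
  rewrite Rplus_0_l in *.
  set (Dn := (p + x) ^ 2 + y ^ 2) in *.
  assert (EN : (p - x) ^ 2 + (0 - y) ^ 2 = Dn - 4 * p * x) by (unfold Dn; ring).
  rewrite EN in G.
  assert (N0 : 0 <= Dn - 4 * p * x) by (rewrite <- EN; apply sum_sqr_ge0).
  assert (He : 1 + - lam * x <= exp (- lam * x)) by apply exp_ineq1_le.
  set (r := 4 * p * x / Dn).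
  assert (Er : 4 * p * x = r * Dn) by (unfold r; field; lra).
  assert (Hr : 0 <= r) by (apply Rdiv_le_0_compat; [| lra]; apply Rmult_le_pos; lra).
  assert (Hlx : 0 <= lam * x) by nra.
  rewrite Er in *.
  apply Rmult_le_reg_r with Dn; [exact Hnd |].
  assert (G2 : (Dn - r * Dn) * (1 + - lam * x) <= delta ^ 2 * Dn).
  { apply Rle_trans with (2 := G). apply Rmult_le_compat_l; assumption. }
  assert (0 <= lam * x * (r * Dn)) by (apply Rmult_le_pos; [lra | apply Rmult_le_pos; lra]).
  nra.
Qed.

(** * Asymptotics *)

Lemma large_P_eventually (x0 c0 b0 : R) :
  0 < x0 -> 0 <= c0 ->
  exists P0, forall P lam, P0 <= P -> lam * P ^ 3 = 2 * x0 ^ 2 -> large_P x0 c0 b0 lam P.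
Proof.
  (* The summand 1 ensures [P <= P ^ 2 <= P ^ 4], so a bound linear in [P] settles the conditions on
     the higher powers too. *)
  intros Hx0 Hc0. exists (1 + 32 * x0 + 4 * x0 * Rabs b0 + 4096 * c0 * x0 ^ 2).
  intros P lam HP Hlam.
  assert (Hb := Rabs_pos b0). assert (Hb' := Rle_abs b0).
  assert (H1 : 0 <= 4 * x0 * Rabs b0) by (apply Rmult_le_pos; lra).
  assert (H2 : 0 <= 4096 * c0 * x0 ^ 2)
    by (apply Rmult_le_pos; [lra | apply pow2_ge_0]).
  assert (H3 : P <= P ^ 2) by nra. assert (H4 : P ^ 2 <= P ^ 4) by nra.
  assert (H5 : 4 * x0 * b0 <= 4 * x0 * Rabs b0) by (apply Rmult_le_compat_l; lra).
  split; [exact Hlam | lra | lra | lra].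
Qed.

(* Writing [d = (1 - delta ^ 2) / (4 x0 / P)] and [t = p / P], the value at [P] gives
   [d >= 1 - e], the point with real part [x0] gives [d <= 1 / t + e], and the edge point
   with real part [P ^ 2 / x0] gives [d <= 1 / 2 + t / (2 (1 - e))]. *)
Lemma best_scaled (K : C -> Prop) (x0 c0 b0 lam P p delta e : R) :
  robin_domain K x0 c0 b0 -> 0 < e <= 1 / 40 ->
  1 <= P -> 8 * x0 <= e ^ 2 * P -> x0 * b0 <= P ^ 2 -> c0 * x0 ^ 2 <= e * P ^ 4 ->
  lam * P ^ 3 = 2 * x0 ^ 2 -> 0 < p -> best K lam (RtoC p) delta ->
  Rabs (p / P - 1) <= 14 * e /\ Rabs ((1 - delta) / (2 * x0 / p) - 1) <= 14 * e.
Proof.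
  intros HK He HP HPx HPb HPc Hlam Hp [Hsup Hmin].
  assert (Hx0 := rd_pos _ _ _ _ HK). assert (Hc0 := rd_nneg _ _ _ _ HK).
  assert (Hl : 0 < lam).
  { apply Rmult_lt_reg_r with (P ^ 3); [apply pow_lt; lra |]. rewrite Hlam. nra. }
  destruct (rd_attained _ _ _ _ HK) as [y0 Hs0].
  assert (Hd0 : 0 <= delta) by (apply Rle_trans with (2 := Hsup _ Hs0); apply robin_val_ge0).
  set (t := p / P). set (d := (1 - delta ^ 2) * P / (4 * x0)).
  assert (Et : p = t * P) by (unfold t; field; lra).
  assert (Ed : 1 - delta ^ 2 = d * (4 * x0 / P)) by (unfold d; field; lra).
  assert (Ht : 0 < t) by (apply Rdiv_lt_0_compat; lra).
  assert (HxP0 : 0 < 4 * x0 / P) by (apply Rdiv_lt_0_compat; lra).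
  assert (HxP : 4 * x0 / P <= e ^ 2 / 2) by (apply Rle_div_l; lra).
  assert (He2 : e ^ 2 <= e / 40).
  { replace (e ^ 2) with (e * e) by ring. replace (e / 40) with (e * (1 / 40)) by field.
    apply Rmult_le_compat_l; lra. }
  assert (D1 : 1 - e <= d).
  { assert (G := Hmin _ _ (sup_le_at_P K x0 c0 b0 lam P e HK ltac:(lra) ltac:(lra) Hlam
                            ltac:(lra))).
    assert (B : 4 * x0 / P * (1 - e) <= 4 * x0 / P * 1) by (apply Rmult_le_compat_l; lra).
    apply sqr_le_of_le_sqrt in G; [| lra | lra].
    apply Rmult_le_reg_r with (4 * x0 / P); [lra |]. lra. }
  assert (Hd1 : delta <= 1).
  { assert (0 <= d * (4 * x0 / P)) by (apply Rmult_le_pos; lra). nra. }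
  assert (Hlp : lam * P ^ 2 = 2 * x0 ^ 2 / P) by (rewrite <- Hlam; field; lra).
  assert (D2 : d <= / t + e).
  { assert (G := sup_le_lower K x0 c0 b0 lam p delta x0 y0 HK ltac:(lra) Hp ltac:(lra) Hsup Hs0).
    assert (G1 : 4 * p * x0 / ((p + x0) ^ 2 + y0 ^ 2) <= 4 * x0 / p).
    { assert (Q := pow2_ge_0 y0).
      apply Rle_trans with (4 * p * x0 / p ^ 2).
      - apply Rmult_le_compat_l; [apply Rmult_le_pos; lra |].
        apply Rinv_le_contravar; [apply pow_lt; lra | nra].
      - right. field. lra. }
    assert (G2 : lam * x0 <= e * (4 * x0 / P)).
    { assert (B : lam * P <= 4 * e); [| apply Rle_trans with (lam * P * (x0 / P));
        [right; field; lra |]].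
      - apply Rmult_le_reg_r with P; [lra |].
        replace (lam * P * P) with (lam * P ^ 2) by ring. rewrite Hlp.
        replace (2 * x0 ^ 2 / P) with (x0 / 2 * (4 * x0 / P)) by (field; lra). nra.
      - replace (e * (4 * x0 / P)) with (4 * e * (x0 / P)) by (field; lra).
        apply Rmult_le_compat_r; [apply Rdiv_le_0_compat; lra | exact B]. }
    apply Rmult_le_reg_r with (4 * x0 / P); [lra |]. rewrite <- Ed.
    replace ((/ t + e) * (4 * x0 / P)) with (4 * x0 / p + e * (4 * x0 / P))
      by (rewrite Et; field; lra).
    lra. }
  assert (D3 : d <= 1 / 2 + t / (2 * (1 - e))).
  { set (x := P ^ 2 / x0).
    assert (Ex : x * x0 = P ^ 2) by (unfold x; field; lra).
    assert (Hx : 0 < x) by (apply Rdiv_lt_0_compat; [apply pow_lt; lra | lra]).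
    assert (Hbx : b0 <= x) by (apply Rmult_le_reg_r with x0; lra).
    assert (Hcx : c0 <= e * x ^ 2).
    { apply Rmult_le_reg_r with (x0 ^ 2); [apply pow_lt; lra |].
      replace (e * x ^ 2 * x0 ^ 2) with (e * (x * x0) ^ 2) by ring. rewrite Ex.
      replace (e * (P ^ 2) ^ 2) with (e * P ^ 4) by ring. lra. }
    assert (Hx2 : 0 < x ^ 2) by (apply pow_lt; lra).
    assert (Hs := rd_edge _ _ _ _ HK x Hbx).
    assert (G := sup_le_lower K x0 c0 b0 lam p delta _ _ HK ltac:(lra) Hp ltac:(lra) Hsup Hs).
    rewrite pow2_sqrt in G by nra.
    assert (G1 : 4 * p * x / ((p + x) ^ 2 + (x ^ 2 - c0)) <= 2 * p / (x * (1 - e))).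
    { apply Rle_trans with (4 * p * x / (2 * (x ^ 2 * (1 - e)))).
      - apply Rmult_le_compat_l; [apply Rmult_le_pos; lra |].
        apply Rinv_le_contravar; nra.
      - right. field. lra. }
    assert (G2 : lam * x = 1 / 2 * (4 * x0 / P)).
    { unfold x. replace (lam * (P ^ 2 / x0)) with (lam * P ^ 2 / x0) by (field; lra).
      rewrite Hlp. field. lra. }
    assert (G3 : 2 * p / (x * (1 - e)) = t / (2 * (1 - e)) * (4 * x0 / P)).
    { rewrite Et. unfold x. field. lra. }
    apply Rmult_le_reg_r with (4 * x0 / P); [lra |]. rewrite <- Ed. lra. }
  (* [D1] with [D2] bounds [t] from above, [D1] with [D3] bounds it from below. *)
  assert (T1 : t * (1 - 2 * e) <= 1).
  { assert (t * (1 - 2 * e) <= t * / t) by (apply Rmult_le_compat_l; lra).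
    rewrite Rinv_r in H by lra. exact H. }
  assert (T2 : 1 - 3 * e <= t).
  { assert (B : 1 / 2 - e <= t / (2 * (1 - e))) by lra.
    apply Rle_div_r in B; [| lra]. nra. }
  assert (T3 : t <= 1 + 4 * e) by nra.
  assert (D4 : d <= 1 + 7 * e).
  { assert (/ t <= 1 + 6 * e); [| lra].
    apply Rmult_le_reg_l with t; [lra |]. rewrite Rinv_r by lra. nra. }
  assert (Hdel : 1 - delta <= e).
  { assert (1 - delta ^ 2 <= e) by (rewrite Ed; nra). nra. }
  split; [apply Rabs_le_between; lra |].
  set (w := (1 - delta) / (2 * x0 / p)).
  (* This is [1 - delta ^ 2 = (1 - delta) (1 + delta)] rescaled; since [d], [t] and [delta] are all
     close to 1, so is [w]. *)
  assert (Ew : w * (1 + delta) = 2 * d * t).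
  { unfold w, d, t. field. lra. }
  assert (W0 : 0 <= w).
  { apply Rdiv_le_0_compat; [lra | apply Rdiv_lt_0_compat; lra]. }
  assert (B1 : (1 - e) * (1 - 3 * e) <= d * t) by (apply Rmult_le_compat; lra).
  assert (B2 : d * t <= (1 + 7 * e) * (1 + 4 * e)) by (apply Rmult_le_compat; lra).
  apply Rabs_le_between. split; nra.
Qed.

Lemma best_asymptotics (K : C -> Prop) (x0 c0 b0 eps : R) :
  robin_domain K x0 c0 b0 -> 0 < eps ->
  exists P0, forall lam P p delta,
    P0 <= P -> lam * P ^ 3 = 2 * x0 ^ 2 -> 0 < p -> best K lam (RtoC p) delta ->
    Rabs (p / P - 1) < eps /\ Rabs ((1 - delta) / (2 * x0 / p) - 1) < eps.
Proof.
  intros HK Heps.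
  assert (Hx0 := rd_pos _ _ _ _ HK). assert (Hc0 := rd_nneg _ _ _ _ HK).
  set (e := Rmin (eps / 20) (1 / 40)).
  assert (He : 0 < e) by (apply Rmin_glb_lt; lra).
  assert (He1 : e <= eps / 20) by apply Rmin_l.
  assert (He2 : e <= 1 / 40) by apply Rmin_r.
  clearbody e.
  assert (Hee : 0 < e ^ 2) by (apply pow_lt; lra).
  assert (H1 : 0 <= 8 * x0 / e ^ 2) by (apply Rdiv_le_0_compat; lra).
  assert (H2 : 0 <= x0 * Rabs b0) by (apply Rmult_le_pos; [lra | apply Rabs_pos]).
  assert (H3 : 0 <= c0 * x0 ^ 2 / e)
    by (apply Rdiv_le_0_compat; [apply Rmult_le_pos; [lra | apply pow2_ge_0] | lra]).
  exists (1 + 8 * x0 / e ^ 2 + x0 * Rabs b0 + c0 * x0 ^ 2 / e).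
  intros lam P p delta HP Hlam Hp Hbest.
  assert (Q2 : P <= P ^ 2) by nra. assert (Q4 : P ^ 2 <= P ^ 4) by nra.
  destruct (best_scaled K x0 c0 b0 lam P p delta e) as [R1 R2]; try assumption; try lra.
  - assert (G : 8 * x0 / e ^ 2 <= P) by lra. apply Rle_div_l in G; lra.
  - assert (x0 * b0 <= x0 * Rabs b0) by (apply Rmult_le_compat_l; [lra | apply Rle_abs]).
    lra.
  - assert (G : c0 * x0 ^ 2 / e <= P ^ 4) by lra.
    apply Rmult_le_compat_l with (r := e) in G; [| lra].
    replace (e * (c0 * x0 ^ 2 / e)) with (c0 * x0 ^ 2) in G by (field; lra). exact G.
Qed.

(** * The set of square roots and its minimal real part *)

Lemma csqrt_spec (a b : R) :
  exists x y, csqrt (a, b) = (x, y) /\ 0 <= x /\ x ^ 2 - y ^ 2 = a /\ 2 * (x * y) = b.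
Proof.
  unfold csqrt. rewrite Cmod_pair. cbn [Re Im fst snd].
  set (m := sqrt (a ^ 2 + b ^ 2)).
  assert (Em : m ^ 2 = a ^ 2 + b ^ 2) by (apply pow2_sqrt; apply sum_sqr_ge0).
  assert (Hm : 0 <= m) by apply sqrt_pos.
  assert (Ha : Rabs a <= m).
  { apply Rsqr_incr_0; [| apply Rabs_pos | exact Hm].
    rewrite <- Rsqr_abs. unfold Rsqr. assert (G := pow2_ge_0 b). nra. }
  apply Rabs_le_between in Ha.
  assert (Hp : 0 <= (m + a) / 2) by lra. assert (Hq : 0 <= (m - a) / 2) by lra.
  set (sg := if Rlt_dec b 0 then -1 else 1).
  assert (Esg : sg ^ 2 = 1 /\ sg * Rabs b = b).
  { unfold sg. destruct (Rlt_dec b 0).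
    - rewrite Rabs_left by lra. split; ring.
    - rewrite Rabs_pos_eq by lra. split; ring. }
  destruct Esg as [Es1 Es2].
  exists (sqrt ((m + a) / 2)), (sg * sqrt ((m - a) / 2)).
  split; [reflexivity | split; [apply sqrt_pos | split]].
  - rewrite Rpow_mult_distr, Es1, !pow2_sqrt by assumption. field.
  - replace (2 * (sqrt ((m + a) / 2) * (sg * sqrt ((m - a) / 2)))) with
      (sg * (2 * (sqrt ((m + a) / 2) * sqrt ((m - a) / 2)))) by ring.
    rewrite <- sqrt_mult by assumption.
    replace ((m + a) / 2 * ((m - a) / 2)) with (Rsqr (b / 2)).
    + rewrite sqrt_Rsqr_abs. unfold Rdiv. rewrite Rabs_mult, (Rabs_pos_eq (/ 2)) by lra.
      rewrite <- Es2 at 2. field.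
    + unfold Rsqr. replace ((m + a) / 2 * ((m - a) / 2)) with ((m ^ 2 - a ^ 2) / 4) by field.
      rewrite Em. field.
Qed.

(** Eliminating [y] from the equations of the two roots gives
    [(x ^ 2 - x' ^ 2) (x ^ 2 + y' ^ 2) = 0], whose second factor is positive. *)
Lemma csqrt_unique (a b x y : R) :
  0 < x -> x ^ 2 - y ^ 2 = a -> 2 * (x * y) = b -> csqrt (a, b) = (x, y).
Proof.
  intros Hx Ha Hb.
  destruct (csqrt_spec a b) as [x' [y' [E [Hx' [Ha' Hb']]]]]. rewrite E.
  assert (Exy : (x ^ 2 - x' ^ 2) * (x ^ 2 + y' ^ 2) = 0).
  { assert (E1 : x ^ 2 * y ^ 2 = x' ^ 2 * y' ^ 2).
    { replace (x ^ 2 * y ^ 2) with ((2 * (x * y)) ^ 2 / 4) by field.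
      rewrite Hb, <- Hb'. field. }
    assert (E2 : y ^ 2 = x ^ 2 - x' ^ 2 + y' ^ 2) by lra.
    rewrite E2 in E1. lra. }
  assert (Hpos : 0 < x ^ 2 + y' ^ 2) by (apply sum_sqr_gt0; left; lra).
  apply Rmult_integral in Exy. destruct Exy as [Exx | Exx]; [| lra].
  assert (Ex : x' = x).
  { assert ((x - x') * (x + x') = 0) by lra.
    apply Rmult_integral in H. destruct H; lra. }
  subst x'. f_equal. apply Rmult_eq_reg_l with x; lra.
Qed.

(* The values of the square root in [rho], described by its defining equations. *)
Definition freq_set (nu a b c km wm : R) (s : C) : Prop :=
  exists w k, Dinf km wm w k /\ 0 < Re s /\
    Re s ^ 2 - Im s ^ 2 = x0sq nu a b + 4 * nu ^ 2 * k ^ 2 /\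
    Re s * Im s = 2 * nu * (w + c * k).

Lemma x0sq_ge0 (nu a b : R) : 0 < nu -> 0 <= b -> 0 <= x0sq nu a b.
Proof.
  intros Hnu Hb. unfold x0sq. assert (G := pow2_ge_0 a).
  assert (0 <= nu * b) by (apply Rmult_le_pos; lra). lra.
Qed.

(** A vanishing real part would force [k = 0] by the first equation and then [w = 0] by the second,
    against [wm <= |w|]. *)
Lemma freq_re_gt0 (nu X c wm w k x y : R) :
  0 < nu -> 0 <= X -> 0 < wm -> wm <= Rabs w -> 0 <= x ->
  x ^ 2 - y ^ 2 = X + 4 * nu ^ 2 * k ^ 2 -> x * y = 2 * nu * (w + c * k) -> 0 < x.
Proof.
  intros Hnu HX Hwm Hw Hx E1 E2.
  destruct (Req_dec x 0) as [-> | N]; [exfalso | lra].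
  assert (Hnk : 0 <= nu ^ 2 * k ^ 2) by (apply Rmult_le_pos; apply pow2_ge_0).
  assert (Hy := pow2_ge_0 y).
  assert (Hk : nu ^ 2 * k ^ 2 = 0) by lra.
  assert (k = 0).
  { apply Rmult_integral in Hk. destruct Hk as [Hk | Hk].
    - apply pow_nonzero in Hk; [contradiction | lra].
    - destruct (Req_dec k 0) as [|Nk]; [assumption |].
      exfalso. exact (pow_nonzero k 2 Nk Hk). }
  subst k. rewrite Rmult_0_l, Rmult_0_r, Rplus_0_r in E2.
  symmetry in E2. apply Rmult_integral in E2. destruct E2 as [E2 | E2]; [lra |].
  subst w. rewrite Rabs_R0 in Hw. lra.
Qed.

Lemma Cmod_cexp (z : C) : Cmod (cexp z) = exp (Re z).
Proof.
  unfold cexp. rewrite Cmod_pair.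
  replace ((exp (Re z) * cos (Im z)) ^ 2 + (exp (Re z) * sin (Im z)) ^ 2) with
    (Rsqr (exp (Re z)) * (Rsqr (sin (Im z)) + Rsqr (cos (Im z)))) by (unfold Rsqr; ring).
  rewrite sin2_cos2, Rmult_1_r. apply sqrt_Rsqr. left. apply exp_pos.
Qed.

Lemma Cmod_rho (nu a b c w k L : R) (p : C) :
  0 < nu ->
  Cmod (rho nu a b c w k p 0 L) =
  robin_val (L / nu) p (csqrt (x0sq nu a b + 4 * nu ^ 2 * k ^ 2, 4 * nu * (w + c * k))).
Proof.
  intros Hnu. unfold rho, robin_val.
  set (s := csqrt _). set (s' := csqrt _).
  assert (E : s = s').
  { unfold s, s'. f_equal. unfold RtoC, Cplus, Cmult; cbn [fst snd]. f_equal; ring. }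
  rewrite E. rewrite Cmod_mult, Cmod_cexp. f_equal.
  - rewrite Cmult_0_l, Cplus_0_r. reflexivity.
  - f_equal. cbn. unfold Re. field. lra.
Qed.

Lemma robin_sup_ksup (nu a b c km wm L : R) (p : C) :
  0 < nu -> 0 <= b -> 0 < wm ->
  robin_sup nu a b c km wm L p = ksup (freq_set nu a b c km wm) (L / nu) p.
Proof.
  intros Hnu Hb Hwm. unfold robin_sup, ksup. apply Lub_Rbar_eqset. intros r. split.
  - intros [w [k [HD ->]]]. rewrite Cmod_rho by exact Hnu.
    destruct (csqrt_spec (x0sq nu a b + 4 * nu ^ 2 * k ^ 2) (4 * nu * (w + c * k)))
      as [x [y [E [Hx [E1 E2]]]]].
    exists (x, y). rewrite E. split; [| reflexivity].
    exists w, k. cbn [Re Im fst snd].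
    assert (E2' : x * y = 2 * nu * (w + c * k)) by lra.
    split; [exact HD | split; [| split; [exact E1 | exact E2']]].
    apply (freq_re_gt0 nu (x0sq nu a b) c wm w k x y); try assumption.
    + apply x0sq_ge0; assumption.
    + apply HD.
  - intros [[x y] [[w [k [HD [Hx [E1 E2]]]]] ->]]. cbn [Re Im fst snd] in *.
    exists w, k. split; [exact HD |]. rewrite Cmod_rho by exact Hnu.
    rewrite (csqrt_unique _ _ x y Hx E1); [reflexivity | lra].
Qed.

(** [phi / 4], taken at [xi = w + c k], is the real part of the square root at the frequency
    [(w, k)]. *)
Lemma phi_spec (nu a b c wm w k x : R) :
  0 < nu -> 0 <= b -> 0 < wm -> wm <= Rabs w -> x = phi nu a b k (w + c * k) / 4 ->
  exists y, 0 < x /\ x ^ 2 - y ^ 2 = x0sq nu a b + 4 * nu ^ 2 * k ^ 2 /\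
    x * y = 2 * nu * (w + c * k).
Proof.
  intros Hnu Hb Hwm Hw Ephi.
  destruct (csqrt_spec (x0sq nu a b + 4 * nu ^ 2 * k ^ 2) (4 * nu * (w + c * k)))
    as [x' [y [E [Hx [E1 E2]]]]].
  assert (E2' : x' * y = 2 * nu * (w + c * k)) by lra.
  assert (Ex : x = x').
  { rewrite Ephi. apply (f_equal fst) in E. cbn [fst] in E. rewrite <- E.
    unfold csqrt, phi; cbn [fst]. rewrite Cmod_pair; cbn [Re fst].
    set (U := x0sq nu a b + 4 * nu ^ 2 * k ^ 2).
    replace ((4 * nu * (w + c * k)) ^ 2) with (16 * nu ^ 2 * (w + c * k) ^ 2) by ring.
    set (m := sqrt (U ^ 2 + 16 * nu ^ 2 * (w + c * k) ^ 2)).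
    replace (m + U) with (2 * ((m + U) / 2)) at 1 by field.
    rewrite sqrt_mult_alt by lra.
    replace (2 * sqrt 2 * (sqrt 2 * sqrt ((m + U) / 2)) / 4) with
      (sqrt 2 * sqrt 2 * sqrt ((m + U) / 2) / 2) by field.
    rewrite sqrt_sqrt by lra. field. }
  subst x'. exists y. split; [| split; assumption].
  apply (freq_re_gt0 nu (x0sq nu a b) c wm w k x y); try assumption.
  apply x0sq_ge0; assumption.
Qed.

Lemma freq_equation (nu X c w k x y : R) :
  x ^ 2 - y ^ 2 = X + 4 * nu ^ 2 * k ^ 2 -> x * y = 2 * nu * (w + c * k) ->
  x ^ 2 * (x ^ 2 - X - 4 * nu ^ 2 * k ^ 2) = 4 * nu ^ 2 * (w + c * k) ^ 2.
Proof.
  intros E1 E2.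
  replace (x ^ 2 - X - 4 * nu ^ 2 * k ^ 2) with (y ^ 2) by lra.
  replace (x ^ 2 * y ^ 2) with ((x * y) ^ 2) by ring. rewrite E2. ring.
Qed.

(** [T] is the larger root of the quadratic equation in the conclusion; it is the minimal squared
    real part when [km <= kb]. The third property says that [kb] is the vertex of the parabola
    [(wm - |c| k) ^ 2 + T k ^ 2]. *)
Lemma kbar_spec (nu a b c wm : R) :
  0 < nu -> 0 <= b -> 0 < wm ->
  let kb := kbar nu a b c wm in
  let X := x0sq nu a b in
  exists T, X < T /\ (T - X) * (T + c ^ 2) = 4 * nu ^ 2 * wm ^ 2 /\
    kb * (T + c ^ 2) = wm * Rabs c /\ 0 <= kb /\ Rabs c * kb <= wm.
Proof.
  intros Hnu Hb Hwm kb X.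
  assert (HX : 0 <= X) by (apply x0sq_ge0; assumption).
  assert (Hc := pow2_ge_0 c). assert (Hac := Rabs_pos c). assert (Ec := pow2_abs c).
  set (Y := c ^ 2 + X). set (S := sqrt (Y ^ 2 + 16 * nu ^ 2 * wm ^ 2)).
  assert (Hnw : 0 < nu ^ 2 * wm ^ 2) by (apply Rmult_lt_0_compat; apply pow_lt; lra).
  assert (HY : 0 <= Y) by (unfold Y; lra).
  assert (ES : S ^ 2 = Y ^ 2 + 16 * nu ^ 2 * wm ^ 2).
  { apply pow2_sqrt. assert (G := pow2_ge_0 Y). lra. }
  assert (HS : Y < S).
  { apply Rsqr_incrst_0; [unfold Rsqr; lra | exact HY | apply sqrt_pos]. }
  assert (Ekb : kb = Rabs c * (S - Y) / (8 * nu ^ 2 * wm)) by reflexivity.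
  set (T := (S + X - c ^ 2) / 2).
  assert (ET : T + c ^ 2 = (S + Y) / 2) by (unfold T, Y; field).
  assert (Hkb : 0 <= kb).
  { rewrite Ekb. assert (0 < nu ^ 2 * wm) by (apply Rmult_lt_0_compat; [apply pow_lt |]; lra).
    apply Rdiv_le_0_compat; [apply Rmult_le_pos; lra | lra]. }
  assert (HT : X < T) by (unfold T, Y in *; lra).
  assert (EkT : kb * (T + c ^ 2) = wm * Rabs c).
  { rewrite ET, Ekb.
    replace (Rabs c * (S - Y) / (8 * nu ^ 2 * wm) * ((S + Y) / 2)) with
      (Rabs c * (S ^ 2 - Y ^ 2) / (16 * nu ^ 2 * wm)) by (field; lra).
    rewrite ES. field. lra. }
  exists T. split; [exact HT | split; [| split; [exact EkT | split; [exact Hkb |]]]].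
  - rewrite ET. replace (T - X) with ((S - Y) / 2) by (unfold T, Y; field).
    replace ((S - Y) / 2 * ((S + Y) / 2)) with ((S ^ 2 - Y ^ 2) / 4) by field.
    rewrite ES. field.
  - apply Rmult_le_reg_r with (T + c ^ 2); [lra |].
    rewrite Rmult_assoc, EkT.
    replace (Rabs c * (wm * Rabs c)) with (wm * Rabs c ^ 2) by ring. rewrite Ec. nra.
Qed.

(* For fixed [T], [4 nu ^ 2 ((wm - |c| k) ^ 2 + T k ^ 2)] is quadratic in [k], with minimum
   [4 nu ^ 2 wm ^ 2 T / (T + c ^ 2)]. *)
Lemma kbar_min (nu X c wm k T Tb : R) :
  0 <= X -> 0 < T -> X < Tb ->
  (Tb - X) * (Tb + c ^ 2) = 4 * nu ^ 2 * wm ^ 2 ->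
  4 * nu ^ 2 * (wm - Rabs c * k) ^ 2 <= T * (T - X - 4 * nu ^ 2 * k ^ 2) ->
  Tb <= T.
Proof.
  intros HX HT HTb Eb H.
  assert (Hc := pow2_ge_0 c). assert (Ec := pow2_abs c). set (ac := Rabs c) in *.
  assert (Hsq : 0 <= nu ^ 2 * ((T + ac ^ 2) * k - wm * ac) ^ 2)
    by (apply Rmult_le_pos; apply pow2_ge_0).
  assert (Hm : (T + ac ^ 2) * (4 * nu ^ 2 * (wm - ac * k) ^ 2) <=
               (T + ac ^ 2) * (T * (T - X - 4 * nu ^ 2 * k ^ 2)))
    by (apply Rmult_le_compat_l; lra).
  assert (Hk : 4 * nu ^ 2 * wm ^ 2 * T <= (T - X) * (T + ac ^ 2) * T) by nra.
  apply Rmult_le_reg_r in Hk; [| exact HT].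
  rewrite Ec, <- Eb in Hk.
  destruct (Rle_dec Tb T) as [|n]; [assumption | exfalso].
  assert ((T - X) * (T + c ^ 2) < (Tb - X) * (Tb + c ^ 2)) by nra.
  lra.
Qed.

(** The lower bound on [km] says that the vertex of the parabola [(wm - |c| k) ^ 2 + Tm k ^ 2] is
    not to the right of [km], so the parabola is nondecreasing from there on. For [T < Tm], the
    right side of the last hypothesis is smaller than with [Tm] in place of [T], which gives a
    contradiction. *)
Lemma km_min (nu X c wm km k T Tm : R) :
  0 <= X -> 0 < T -> 0 < Tm -> 0 <= km <= k ->
  wm * Rabs c <= km * (Tm + c ^ 2) ->
  Tm * (Tm - X - 4 * nu ^ 2 * km ^ 2) = 4 * nu ^ 2 * (wm - Rabs c * km) ^ 2 ->
  4 * nu ^ 2 * (wm - Rabs c * k) ^ 2 <= T * (T - X - 4 * nu ^ 2 * k ^ 2) ->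
  Tm <= T.
Proof.
  intros HX HT HTm Hk Hkm Em H.
  assert (Hc := pow2_ge_0 c). assert (Ec := pow2_abs c). set (ac := Rabs c) in *.
  rewrite <- Ec in *.
  destruct (Rle_dec Tm T) as [|n]; [assumption | exfalso].
  assert (Hn := pow2_ge_0 nu).
  assert (HG : 0 <= (k - km) * ((k + km) * (Tm + ac ^ 2) - 2 * (wm * ac))).
  { apply Rmult_le_pos; [lra |].
    assert (km * (Tm + ac ^ 2) <= k * (Tm + ac ^ 2)) by (apply Rmult_le_compat_r; lra).
    lra. }
  assert (HnG := Rmult_le_pos _ _ Hn HG).
  assert (HU : X + 4 * nu ^ 2 * k ^ 2 <= T).
  { assert (0 <= nu ^ 2 * (wm - ac * k) ^ 2) by (apply Rmult_le_pos; [lra | apply pow2_ge_0]).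
    apply Rmult_le_reg_l with T; [exact HT |]. lra. }
  assert (Hd : 0 < (Tm - T) * (Tm + T - X - 4 * nu ^ 2 * k ^ 2))
    by (apply Rmult_lt_0_compat; lra).
  nra.
Qed.

(** As [|w + c k| >= wm - |c| |k|], the choice [|k|] works while [|c| |k| <= wm]. Otherwise
    [wm / |c|] lies between [km] and [|k|], and there the left side vanishes. *)
Lemma freq_set_reduced (nu a b c km wm x y : R) :
  0 < nu -> 0 <= b -> 0 <= km -> Rabs c * km <= wm ->
  freq_set nu a b c km wm (x, y) ->
  exists k, km <= k /\
    4 * nu ^ 2 * (wm - Rabs c * k) ^ 2 <= x ^ 2 * (x ^ 2 - x0sq nu a b - 4 * nu ^ 2 * k ^ 2).
Proof.
  intros Hnu Hb Hkm Hc [w [k [[Hw Hk] [Hx [E1 E2]]]]]. cbn [Re Im fst snd] in *.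
  assert (E : x ^ 2 * (x ^ 2 - x0sq nu a b - 4 * nu ^ 2 * Rabs k ^ 2) =
              4 * nu ^ 2 * (w + c * k) ^ 2).
  { rewrite pow2_abs. exact (freq_equation _ _ _ _ _ _ _ E1 E2). }
  assert (Hn : 0 < nu ^ 2) by (apply pow_lt; lra).
  assert (Hac := Rabs_pos c).
  destruct (Rle_dec (Rabs c * Rabs k) wm) as [Hs | Hs].
  - exists (Rabs k). split; [exact Hk |]. rewrite E.
    apply Rmult_le_compat_l; [lra |]. rewrite <- (pow2_abs (w + c * k)).
    apply pow_incr. split; [lra |].
    assert (G := Rabs_triang_inv w (- (c * k))).
    rewrite Rabs_Ropp, Rabs_mult in G.
    replace (w - - (c * k)) with (w + c * k) in G by ring. lra.
  - assert (Hc0 : 0 < Rabs c).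
    { destruct (Req_dec (Rabs c) 0) as [Z | Z]; [| lra].
      rewrite Z in Hs, Hc. lra. }
    exists (wm / Rabs c). split; [apply Rle_div_r; lra |].
    replace (wm - Rabs c * (wm / Rabs c)) with 0 by (field; lra).
    assert (Hle : (wm / Rabs c) ^ 2 <= Rabs k ^ 2).
    { apply pow_incr. split; [| apply Rle_div_l; lra].
      apply Rdiv_le_0_compat; [| lra]. nra. }
    assert (Hx2 : 0 < x ^ 2) by (apply pow_lt; lra).
    assert (Hy := pow2_ge_0 y). rewrite pow2_abs in Hle.
    assert (nu ^ 2 * (wm / Rabs c) ^ 2 <= nu ^ 2 * k ^ 2) by (apply Rmult_le_compat_l; lra).
    rewrite (pow_i 2) by auto with arith. rewrite Rmult_0_r.
    apply Rmult_le_pos; lra.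
Qed.

Lemma sign_exists (c : R) : exists sg, sg ^ 2 = 1 /\ Rabs sg = 1 /\ c * sg = Rabs c.
Proof.
  destruct (Rle_dec 0 c).
  - exists 1. rewrite Rabs_R1, (Rabs_pos_eq c) by lra. repeat split; ring.
  - exists (-1). rewrite (Rabs_left (-1)), (Rabs_left c) by lra. repeat split; ring.
Qed.

(** The value is realized by the frequency [(- wm, sg * k)] with [sg] the sign of [c], where the
    drift term opposes [- wm]. *)
Lemma freq_set_boundary (nu a b c km wm k x : R) :
  0 < nu -> 0 <= b -> 0 < wm -> 0 <= km <= k ->
  x = phi nu a b k (- wm + Rabs c * k) / 4 ->
  0 < x /\ (exists y, freq_set nu a b c km wm (x, y)) /\
  x ^ 2 * (x ^ 2 - x0sq nu a b - 4 * nu ^ 2 * k ^ 2) = 4 * nu ^ 2 * (wm - Rabs c * k) ^ 2.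
Proof.
  intros Hnu Hb Hwm Hk Ex.
  destruct (sign_exists c) as [sg [Es1 [Es2 Es3]]].
  assert (Ew : Rabs (- wm) = wm) by (rewrite Rabs_Ropp; apply Rabs_pos_eq; lra).
  assert (Ek2 : (sg * k) ^ 2 = k ^ 2) by (rewrite Rpow_mult_distr, Es1; ring).
  assert (Eck : c * (sg * k) = Rabs c * k) by (rewrite <- Es3; ring).
  destruct (phi_spec nu a b c wm (- wm) (sg * k) x) as [y [Hx [E1 E2]]]; try assumption.
  { lra. }
  { rewrite Ex, Eck. unfold phi. rewrite Ek2. reflexivity. }
  split; [exact Hx | split].
  - exists y, (- wm), (sg * k). cbn [Re Im fst snd].
    split; [split | repeat split; assumption].
    + lra.
    + rewrite Rabs_mult, Es2, Rmult_1_l, Rabs_pos_eq; lra.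
  - rewrite <- Ek2. rewrite (freq_equation _ _ _ _ _ _ _ E1 E2), Eck. ring.
Qed.

(** For [km <= kb] the unconstrained vertex is admissible; past it, the minimum sits at [km]. Once
    [|c| km > wm], the frequency [w = - c km] is admissible and cancels the imaginary part, so only
    [|k| >= km] limits the real part. *)
Lemma Aconst_min (nu a b c km wm : R) :
  0 < nu -> 0 <= b -> 0 <= km -> 0 < wm ->
  let x0 := Aconst nu a b c km wm / 4 in
  0 < x0 /\ (exists y, freq_set nu a b c km wm (x0, y)) /\
  forall x y, freq_set nu a b c km wm (x, y) -> x0 <= x.
Proof.
  intros Hnu Hb Hkm Hwm x0.
  assert (HX : 0 <= x0sq nu a b) by (apply x0sq_ge0; assumption).
  assert (Hroot : forall x x' : R, 0 < x -> 0 < x' -> x ^ 2 <= x' ^ 2 -> x <= x').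
  { intros x x' Hx Hx' H. apply Rsqr_incr_0; [unfold Rsqr; lra | lra | lra]. }
  destruct (kbar_spec nu a b c wm Hnu Hb Hwm) as [Tb [HTb [Eb [Ekb [Hkb Hckb]]]]].
  unfold Aconst in x0. set (kb := kbar nu a b c wm) in *.
  assert (Hc2 := pow2_abs c). assert (Hac := Rabs_pos c).
  destruct (Rle_dec km kb) as [H1 | H1].
  - destruct (freq_set_boundary nu a b c km wm kb x0 Hnu Hb Hwm (conj Hkm H1) eq_refl)
      as [Hx0 [Hy Eq]].
    split; [exact Hx0 | split; [exact Hy |]].
    intros x y Hs. assert (Hx : 0 < x) by (destruct Hs as [w [k [_ [G _]]]]; exact G).
    destruct (freq_set_reduced nu a b c km wm x y) as [k [Hk Hq]]; try assumption.
    { apply Rle_trans with (2 := Hckb). apply Rmult_le_compat_l; lra. }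
    assert (HT : Tb <= x ^ 2).
    { apply (kbar_min nu (x0sq nu a b) c wm k); try assumption. apply pow_lt; exact Hx. }
    apply Hroot; [exact Hx0 | exact Hx |]. apply Rle_trans with (2 := HT).
    assert (Hx02 : 0 < x0 ^ 2) by (apply pow_lt; exact Hx0).
    assert (HU : x0sq nu a b + 4 * nu ^ 2 * kb ^ 2 <= x0 ^ 2).
    { assert (0 <= nu ^ 2 * (wm - Rabs c * kb) ^ 2) by (apply Rmult_le_pos; apply pow2_ge_0).
      apply Rmult_le_reg_l with (x0 ^ 2); [exact Hx02 |]. lra. }
    (* [Tb] solves the same equation as [x0 ^ 2]; subtracting the two equations excludes
       [Tb < x0 ^ 2]. *)
    assert (EqT : Tb * (Tb - x0sq nu a b - 4 * nu ^ 2 * kb ^ 2) =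
                  4 * nu ^ 2 * (wm - Rabs c * kb) ^ 2).
    { assert (Hpos : Tb + c ^ 2 <> 0) by (assert (G := pow2_ge_0 c); lra).
      assert (Z : (Tb + c ^ 2) * (Tb * (Tb - x0sq nu a b - 4 * nu ^ 2 * kb ^ 2) -
                  4 * nu ^ 2 * (wm - Rabs c * kb) ^ 2) =
                  Tb * ((Tb - x0sq nu a b) * (Tb + c ^ 2) - 4 * nu ^ 2 * wm ^ 2)
                  - 4 * nu ^ 2 * (kb * (Tb + c ^ 2) - wm * Rabs c) ^ 2)
        by (rewrite <- Hc2; ring).
      rewrite Eb, Ekb in Z.
      replace (Tb * (4 * nu ^ 2 * wm ^ 2 - 4 * nu ^ 2 * wm ^ 2) -
        4 * nu ^ 2 * (wm * Rabs c - wm * Rabs c) ^ 2) with 0 in Z by ring.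
      apply Rmult_integral in Z. destruct Z; [contradiction | lra]. }
    destruct (Rle_dec (x0 ^ 2) Tb) as [|n]; [assumption | exfalso].
    assert (0 < (x0 ^ 2 - Tb) * (x0 ^ 2 + Tb - x0sq nu a b - 4 * nu ^ 2 * kb ^ 2))
      by (apply Rmult_lt_0_compat; lra).
    lra.
  (* For [c = 0] the quotient [wm / Rabs c] has no meaning, but both outcomes of the comparison lead
     to the same expression. *)
  - assert (Hcases : (Rabs c * km <= wm /\
        x0 = phi nu a b km (- wm + Rabs c * km) / 4) \/
        (wm < Rabs c * km /\ x0 = phi nu a b km 0 / 4)).
    { unfold x0. destruct (Req_dec c 0) as [Z | Z].
      - left. split; [rewrite Z, Rabs_R0; lra |].
        destruct (Rle_dec km (wm / Rabs c)); [reflexivity |].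
        destruct (Req_EM_T c 0); [reflexivity | contradiction].
      - assert (Hc0 := Rabs_pos_lt c Z).
        destruct (Rle_dec km (wm / Rabs c)) as [H2 | H2].
        + left. split; [| reflexivity]. apply Rle_div_r in H2; lra.
        + right. destruct (Req_EM_T c 0); [contradiction |]. split; [| reflexivity].
          assert (H3 : wm / Rabs c < km) by lra. apply Rlt_div_l in H3; lra. }
    clearbody x0. destruct Hcases as [[Hc E] | [Hc E]].
    + destruct (freq_set_boundary nu a b c km wm km x0 Hnu Hb Hwm (conj Hkm (Rle_refl km)) E)
        as [Hx0 [Hy Eq]].
      split; [exact Hx0 | split; [exact Hy |]].
      intros x y Hs. assert (Hx : 0 < x) by (destruct Hs as [w [k [_ [G _]]]]; exact G).
      destruct (freq_set_reduced nu a b c km wm x y) as [k [Hk Hq]]; try assumption.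
      assert (Hx02 : 0 < x0 ^ 2) by (apply pow_lt; exact Hx0).
      (* Together with [kb < km], this places the vertex belonging to [x0 ^ 2] to the left of [km],
         as [km_min] demands. *)
      assert (HTb0 : Tb <= x0 ^ 2).
      { apply (kbar_min nu (x0sq nu a b) c wm km); try assumption. lra. }
      apply Hroot; [exact Hx0 | exact Hx |].
      apply (km_min nu (x0sq nu a b) c wm km k); try assumption.
      * apply pow_lt; exact Hx.
      * lra.
      * rewrite <- Ekb. assert (G := pow2_ge_0 c). apply Rmult_le_compat; lra.
    + assert (Hkm0 : 0 < km) by nra.
      assert (Hw : wm <= Rabs (- (c * km))).
      { rewrite Rabs_Ropp, Rabs_mult, (Rabs_pos_eq km) by lra. lra. }
      assert (Ez : - (c * km) + c * km = 0) by ring.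
      destruct (phi_spec nu a b c wm (- (c * km)) km x0) as [y0 [Hx0 [E1 E2]]];
        try assumption.
      { rewrite Ez. exact E. }
      split; [exact Hx0 | split].
      * exists y0, (- (c * km)), km. cbn [Re Im fst snd].
        split; [split | repeat split; assumption]; [exact Hw | rewrite Rabs_pos_eq; lra].
      * intros x y [w [k [[_ Hk] [Hx [F1 F2]]]]]. cbn [Re Im fst snd] in *.
        rewrite Ez, Rmult_0_r in E2.
        assert (y0 = 0) by (apply Rmult_integral in E2; destruct E2; [lra | assumption]).
        subst y0. rewrite (pow_i 2) in E1 by auto with arith.
        apply Hroot; [exact Hx0 | exact Hx |].
        assert (Hkk : km ^ 2 <= k ^ 2).
        { rewrite <- (pow2_abs k). apply pow_incr. lra. }
        assert (nu ^ 2 * km ^ 2 <= nu ^ 2 * k ^ 2)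
          by (apply Rmult_le_compat_l; [apply pow2_ge_0 | exact Hkk]).
        assert (Hy := pow2_ge_0 y). lra.
Qed.

Lemma freq_set_domain (nu a b c km wm : R) :
  0 < nu -> 0 <= b -> 0 <= km -> 0 < wm ->
  exists c0 b0, robin_domain (freq_set nu a b c km wm) (Aconst nu a b c km wm / 4) c0 b0.
Proof.
  intros Hnu Hb Hkm Hwm.
  destruct (Aconst_min nu a b c km wm Hnu Hb Hkm Hwm) as [Hx0 [Hatt Hmin]].
  assert (HX : 0 <= x0sq nu a b) by (apply x0sq_ge0; assumption).
  assert (Hnn : forall k, 0 <= nu ^ 2 * k ^ 2)
    by (intros k; apply Rmult_le_pos; apply pow2_ge_0).
  set (c0 := x0sq nu a b + 4 * nu ^ 2 * km ^ 2).
  assert (Hc0 : 0 <= c0) by (unfold c0; specialize (Hnn km); lra).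
  set (z := 2 * nu * (wm + Rabs c * km)).
  assert (Hck : 0 <= Rabs c * km) by (apply Rmult_le_pos; [apply Rabs_pos | lra]).
  assert (Hz : 0 <= z) by (apply Rmult_le_pos; lra).
  exists c0, (1 + c0 + z).
  constructor; try assumption.
  - intros x y [w [k [_ [Hx [E1 _]]]]]. cbn [Re Im fst snd] in *.
    apply Rsqr_incr_0; [| apply Rabs_pos | lra].
    rewrite <- Rsqr_abs. unfold Rsqr. specialize (Hnn k). lra.
  - intros x y [w [k [[Hw Hk] [Hx [E1 E2]]]]]. cbn [Re Im fst snd] in *.
    exists (- w), (- k). cbn [Re Im fst snd].
    split; [split; rewrite Rabs_Ropp; assumption | split; [exact Hx | split]].
    + replace ((- y) ^ 2) with (y ^ 2) by ring. replace ((- k) ^ 2) with (k ^ 2) by ring.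
      exact E1.
    + replace (x * - y) with (- (x * y)) by ring. rewrite E2. ring.
  (* On the curve [k = km] the second equation is solved for [w]; [x >= 1 + c0 + z] gives [y >= 1]
     and [x y >= z], hence [w >= wm]. *)
  - intros x Hx. assert (Hxx : 1 <= x ^ 2 - c0) by nra.
    set (y := sqrt (x ^ 2 - c0)).
    assert (Hy : 1 <= y) by (rewrite <- sqrt_1; apply sqrt_le_1_alt; exact Hxx).
    assert (Ey : y ^ 2 = x ^ 2 - c0) by (apply pow2_sqrt; lra).
    exists (x * y / (2 * nu) - c * km), km. cbn [Re Im fst snd].
    split; [split | split; [lra | split]].
    + assert (G : wm + Rabs c * km <= x * y / (2 * nu)).
      { apply Rle_div_r; [lra |]. unfold z in *. nra. }
      assert (G2 : c * km <= Rabs c * km)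
        by (apply Rmult_le_compat_r; [lra | apply Rle_abs]).
      apply Rle_trans with (2 := Rle_abs _). lra.
    + rewrite Rabs_pos_eq; lra.
    + rewrite Ey. unfold c0. ring.
    + field. lra.
Qed.

(** * Passage to small overlap and conclusion *)

Lemma filterlim_RtoC_one (f : R -> C) :
  (forall eps, 0 < eps -> exists d, 0 < d /\
     forall L, 0 < L < d -> exists r, f L = RtoC r /\ Rabs (r - 1) < eps) ->
  filterlim f (at_right 0) (locally (RtoC 1)).
Proof.
  intros H Q [eps HQ]. destruct (H eps (cond_pos eps)) as [d [Hd HL]].
  exists (mkposreal d Hd). intros L HLb HL0.
  assert (HLd : 0 < L < d).
  { split; [exact HL0 |]. change (Rabs (L - 0) < d) in HLb.
    rewrite Rminus_0_r in HLb. apply Rabs_lt_between in HLb. lra. }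
  destruct (HL L HLd) as [r [E Hr]]. apply HQ. rewrite E. split.
  - exact Hr.
  - apply ball_center.
Qed.

Definition robin_scale (nu A L : R) : R := / 2 * Rpower (nu * A ^ 2 / L) (/ 3).

Lemma robin_scale_cube (nu A L : R) :
  0 < nu -> 0 < A -> 0 < L ->
  0 < robin_scale nu A L /\ L / nu * robin_scale nu A L ^ 3 = 2 * (A / 4) ^ 2.
Proof.
  intros Hnu HA HL. unfold robin_scale.
  assert (Hz : 0 < nu * A ^ 2 / L).
  { apply Rdiv_lt_0_compat; [apply Rmult_lt_0_compat; [lra | apply pow_lt; lra] | lra]. }
  set (z := nu * A ^ 2 / L) in *.
  assert (E : Rpower z (/ 3) ^ 3 = z).
  { rewrite <- Rpower_pow by apply exp_pos. rewrite Rpower_mult.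
    replace (/ 3 * INR 3) with 1 by (cbn; field). apply Rpower_1. exact Hz. }
  split.
  - apply Rmult_lt_0_compat; [lra | apply exp_pos].
  - rewrite Rpow_mult_distr, E. unfold z. field. lra.
Qed.

Lemma robin_scale_large (nu A M : R) :
  0 < nu -> 0 < A ->
  exists L1, 0 < L1 /\ forall L, 0 < L < L1 -> M <= robin_scale nu A L.
Proof.
  intros Hnu HA. set (M' := Rmax M 1).
  assert (HM : M <= M') by apply Rmax_l. assert (HM1 : 1 <= M') by apply Rmax_r.
  assert (HM3 : 0 < M' ^ 3) by (apply pow_lt; lra).
  assert (HA2 : 0 < nu * (2 * (A / 4) ^ 2))
    by (apply Rmult_lt_0_compat; [lra | assert (G : 0 < A ^ 2) by (apply pow_lt; lra); lra]).
  exists (nu * (2 * (A / 4) ^ 2) / M' ^ 3).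
  split; [apply Rdiv_lt_0_compat; assumption |].
  intros L [HL HL1]. destruct (robin_scale_cube nu A L Hnu HA HL) as [HP EP].
  set (P := robin_scale nu A L) in *.
  destruct (Rle_dec M P) as [|n]; [assumption | exfalso].
  assert (HP3 : P ^ 3 <= M' ^ 3) by (apply pow_incr; lra).
  apply Rlt_div_r in HL1; [| exact HM3].
  assert (E : L * P ^ 3 = nu * (2 * (A / 4) ^ 2)) by (rewrite <- EP; field; lra).
  assert (L * P ^ 3 <= L * M' ^ 3) by (apply Rmult_le_compat_l; lra). lra.
Qed.

Lemma robin_solution_best (nu a b c km wm L : R) (p : C) (delta : R) :
  0 < nu -> 0 <= b -> 0 <= km -> 0 < wm ->
  robin_solution nu a b c km wm L p delta <->
  best (freq_set nu a b c km wm) (L / nu) p delta.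
Proof.
  intros Hnu Hb Hkm Hwm.
  destruct (Aconst_min nu a b c km wm Hnu Hb Hkm Hwm) as [_ [[y Hs] _]].
  rewrite <- best_iff by (eexists; exact Hs).
  unfold robin_solution. rewrite robin_sup_ksup by assumption.
  split; intros [H1 H2]; (split; [exact H1 |]); intros p';
    specialize (H2 p'); rewrite robin_sup_ksup in * by assumption; exact H2.
Qed.

Theorem theorem2 (nu b a c km wm : R) :
  0 < nu -> 0 <= b -> 0 <= km -> 0 < wm ->
  (x0sq nu a b + 4 * nu ^ 2 * km ^ 2 <> 0 \/ wm <> 0) ->
  exists L0 : R, 0 < L0 /\
    (forall L : R, 0 < L < L0 ->
       exists! p : C, exists delta : R, robin_solution nu a b c km wm L p delta) /\
    (forall (pstar : R -> C) (dstar : R -> R),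
       (forall L : R, 0 < L < L0 -> robin_solution nu a b c km wm L (pstar L) (dstar L)) ->
       let A := Aconst nu a b c km wm in
       filterlim (fun L => (pstar L / RtoC (/ 2 * Rpower (nu * A ^ 2 / L) (/ 3)))%C)
         (at_right 0) (locally (RtoC 1)) /\
       filterlim (fun L => ((RtoC 1 - RtoC (dstar L)) / (RtoC A / (RtoC 2 * pstar L)))%C)
         (at_right 0) (locally (RtoC 1))).
Proof.
  intros Hnu Hb Hkm Hwm _.
  destruct (freq_set_domain nu a b c km wm Hnu Hb Hkm Hwm) as [c0 [b0 HK]].
  set (K := freq_set nu a b c km wm) in *. set (A := Aconst nu a b c km wm) in *.
  assert (Hx0 := rd_pos _ _ _ _ HK). assert (HA : 0 < A) by lra.
  destruct (large_P_eventually (A / 4) c0 b0 Hx0 (rd_nneg _ _ _ _ HK)) as [P0 HP0].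
  destruct (robin_scale_large nu A P0 Hnu HA) as [L0 [HL0 HL0P]].
  assert (Hlarge : forall L, 0 < L < L0 ->
    large_P (A / 4) c0 b0 (L / nu) (robin_scale nu A L)).
  { intros L HL. apply HP0; [apply HL0P; exact HL |].
    apply robin_scale_cube; [exact Hnu | exact HA | apply HL]. }
  exists L0. split; [exact HL0 | split].
  - intros L HL.
    destruct (best_exists K _ _ _ _ _ HK (Hlarge L HL)) as [p [delta [_ Hbest]]].
    exists (RtoC p). split.
    + exists delta. apply robin_solution_best; assumption.
    + intros q [delta' Hq]. apply robin_solution_best in Hq; try assumption.
      exact (best_unique K _ _ _ _ _ _ _ _ _ HK (Hlarge L HL) Hbest Hq).
  - intros pstar dstar Hsol A'. change A' with A. clear A'.
    (* The given minimizers are complex a priori; uniqueness identifies them with the positive real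
       ones from [best_exists]. *)
    assert (Hreal : forall L, 0 < L < L0 -> exists p, pstar L = RtoC p /\ 0 < p /\
      best K (L / nu) (RtoC p) (dstar L)).
    { intros L HL. assert (Hs := Hsol L HL). apply robin_solution_best in Hs; try assumption.
      destruct (best_exists K _ _ _ _ _ HK (Hlarge L HL)) as [p [delta [Hp Hbest]]].
      assert (E := best_unique K _ _ _ _ _ _ _ _ _ HK (Hlarge L HL) Hs Hbest).
      destruct (robin_scale_cube nu A L Hnu HA (proj1 HL)) as [HP _].
      exists p. rewrite <- E. split; [reflexivity | split; [lra | exact Hs]]. }
    assert (Hasym : forall eps, 0 < eps -> exists d, 0 < d /\ forall L, 0 < L < d ->
      exists p, pstar L = RtoC p /\ 0 < p /\
        Rabs (p / robin_scale nu A L - 1) < eps /\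
        Rabs ((1 - dstar L) / (2 * (A / 4) / p) - 1) < eps).
    { intros eps Heps.
      destruct (best_asymptotics K _ _ _ eps HK Heps) as [P1 HP1].
      destruct (robin_scale_large nu A P1 Hnu HA) as [L1 [HL1 HL1P]].
      exists (Rmin L0 L1). split; [apply Rmin_glb_lt; assumption |].
      intros L [HLp HLm].
      assert (HLa := Rlt_le_trans _ _ _ HLm (Rmin_l _ _)).
      assert (HLb := Rlt_le_trans _ _ _ HLm (Rmin_r _ _)).
      destruct (Hreal L (conj HLp HLa)) as [p [E [Hp Hbest]]].
      exists p. split; [exact E | split; [exact Hp |]].
      apply (HP1 (L / nu)); [apply HL1P; lra | | exact Hp | exact Hbest].
      apply robin_scale_cube; assumption. }
    split; apply filterlim_RtoC_one; intros eps Heps;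
      destruct (Hasym eps Heps) as [d [Hd HL]]; exists d; (split; [exact Hd |]);
      intros L HLd; destruct (HL L HLd) as [p [E [Hp [G1 G2]]]].
    + exists (p / robin_scale nu A L). split; [| exact G1].
      destruct (robin_scale_cube nu A L Hnu HA (proj1 HLd)) as [HP _].
      rewrite E, RtoC_div by lra. reflexivity.
    + exists ((1 - dstar L) / (2 * (A / 4) / p)). split; [| exact G2].
      rewrite E, <- RtoC_mult, <- RtoC_minus.
      assert (0 < A / (2 * p)) by (apply Rdiv_lt_0_compat; lra).
      rewrite <- RtoC_div by lra. rewrite <- RtoC_div by lra. f_equal. field. lra.
Qed.
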